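(* Let $A_1,\dots,A_m\subset\mathbb{F}_q$ be non-empty subsets with $|A_i|=d_i$ and $d_1\le\dots\le d_m$, let $\mathcal{A}=A_1\times\cdots\times A_m$, and let $d$ be a positive integer with $d\le k:=\sum_{i=1}^m(d_i-1)$. For $1\le r\le\dim AC_q(d,\mathcal{A})$, let $d_r(d,\mathcal{A})$ denote the $r$-th generalized Hamming weight of the affine cartesian code $AC_q(d,\mathcal{A})$. Then $$d_r(d,\mathcal{A})=1+\sum_{i=1}^m a_{r,i}\prod_{j=i+1}^m d_j,$$ where $(a_{r,1},\dots,a_{r,m})$ is the $r$-th element of $F_{\ge k-d}$ in ascending lexicographic order.
   Context: $\mathbb{F}_q$ is the finite field with $q$ elements. Put $n=|\mathcal{A}|=d_1\cdots d_m$ and fix an enumeration $P_1,\dots,P_n$ of $\mathcal{A}$. For an integer $e$, $S_{\le e}(\mathcal{A})$ is the $\mathbb{F}_q$-vector space of polynomials $f\in\mathbb{F}_q[x_1,\dots,x_m]$ of total degree at most $e$ with $\deg_{x_i}f<d_i$ for all $i$. Let $ev:S_{\le k}(\mathcal{A})\to\mathbb{F}_q^n$, $f\mapsto(f(P_1),\dots,f(P_n))$ (an injective linear map). The affine cartesian code is $AC_q(d,\mathcal{A}):=ev(S_{\le d}(\mathcal{A}))$. For a linear subspace $D\subseteq\mathbb{F}_q^N$, $\mathrm{Supp}(D)=\{i:\text{there exists }(c_1,\dots,c_N)\in D\text{ with }c_i\ne0\}$. For a linear code $C\subseteq\mathbb{F}_q^N$ of dimension $K$ and $1\le r\le K$,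 the $r$-th generalized Hamming weight of $C$ is $d_r(C)=\min\{|\mathrm{Supp}(D)|:D\subseteq C\text{ a linear subspace},\ \dim D=r\}$. $F=\{0,\dots,d_1-1\}\times\cdots\times\{0,\dots,d_m-1\}$ and $F_{\ge u}=\{(i_1,\dots,i_m)\in F:i_1+\cdots+i_m\ge u\}$. Lexicographic order on $F$: $a<_{lex}b$ iff the first nonzero coordinate of $b-a$ is positive; ''the $r$-th element in ascending order'' means the $r$-th smallest. An empty product equals $1$. *)

(* Defs.v *)
From HB Require Import structures.
From mathcomp Require Import all_boot all_order all_algebra all_field.
From mathcomp Require Export mpoly.

Set Implicit Arguments.
Unset Strict Implicit.
Unset Printing Implicit Defensive.

Import GRing.Theory.
Local Open Scope ring_scope.

Section ReducedPolynomials.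

Variables (F : fieldType) (m : nat) (d : 'I_m -> nat) (e : nat).

(* [msize] is the total degree plus one (and 0 on the zero polynomial). *)
Definition reduced_mpoly : {pred {mpoly F[m]}} :=
  fun p => (msize p <= e.+1)%N
           && all (fun mon : 'X_{1..m} => [forall i, (mon i < d i)%N]) (msupp p).

Definition reduced_monom (mon : 'X_{1..m}) : bool :=
  (mdeg mon <= e)%N && [forall i, (mon i < d i)%N].

Lemma reduced_mpolyE p : (p \in reduced_mpoly) = all reduced_monom (msupp p).
Proof.
rewrite unfold_in; apply/andP/allP => [[Hs /allP Hd] mon Hm | H].
  rewrite /reduced_monom Hd // andbT -ltnS.
  by apply: leq_trans Hs; apply: msize_mdeg_lt.
split; last by apply/allP => mon /H /andP[].
by rewrite msizeE; apply/bigmax_leqP_seq => mon /H /andP[].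
Qed.

Lemma reduced_mpoly_submod : submod_closed reduced_mpoly.
Proof.
split=> [|c p q]; first by rewrite reduced_mpolyE msupp0.
rewrite !reduced_mpolyE => /allP Hp /allP Hq; apply/allP => mon.
move/msuppD_le; rewrite mem_cat => /orP[/msuppZ_le/Hp|/Hq] //.
Qed.

HB.instance Definition _ :=
  GRing.isSubmodClosed.Build F {mpoly F[m]} reduced_mpoly reduced_mpoly_submod.

(* The space S_{<= e} of the polynomials of total degree at most e whose degree
   in the i-th variable is less than d i, for every i. *)
Record reduced := Reduced {
  mpoly_of_reduced :> {mpoly F[m]};
  _ : mpoly_of_reduced \in reduced_mpoly }.

HB.instance Definition _ := [isSub for mpoly_of_reduced].
HB.instance Definition _ := [Choice of reduced by <:].
HB.instance Definition _ := [SubChoice_isSubLmodule of reduced by <:].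

Let mons : seq 'X_{1..m} :=
  [seq bmnm b | b <- enum {: 'X_{1..m < e.+1}} & reduced_monom (bmnm b)].

Let mons_uniq : uniq mons.
Proof.
rewrite map_inj_uniq; last by move=> b1 b2 eq_b; apply: val_inj.
by apply: filter_uniq; apply: enum_uniq.
Qed.

Let mem_mons mon : (mon \in mons) = reduced_monom mon.
Proof.
apply/mapP/idP => [[b]|H]; first by rewrite mem_filter => /andP[Hb _] ->.
have lt_mon : (mdeg mon < e.+1)%N by rewrite ltnS; case/andP: H.
by exists (BMultinom lt_mon); rewrite // mem_filter mem_enum H.
Qed.

Let mon_of (i : 'I_(size mons)) : 'X_{1..m} := nth 0%MM mons i.

Let mon_of_reduced i : reduced_monom (mon_of i).
Proof. by rewrite -mem_mons mem_nth. Qed.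

Fact reduced_vect_axiom : Vector.axiom (size mons) reduced.
Proof.
exists (fun p : reduced => \row_i (p : {mpoly F[m]})@_(mon_of i)) => [c p q|].
  by apply/rowP => i; rewrite !mxE /= mcoeffD mcoeffZ.
pose g (r : 'rV[F]_(size mons)) : {mpoly F[m]} :=
  \sum_i r 0 i *: 'X_[mon_of i].
have gP r : g r \in reduced_mpoly.
  rewrite rpred_sum // => i _; rewrite rpredZ // reduced_mpolyE.
  by rewrite msuppX /= mon_of_reduced.
have g_coef r i : (g r)@_(mon_of i) = r 0 i.
  rewrite /g raddf_sum (bigD1 i) //= mcoeffZ mcoeffX eqxx mulr1.
  rewrite big1 ?addr0 // => j ne_ji; rewrite mcoeffZ mcoeffX.
  by rewrite nth_uniq // (inj_eq val_inj) (negbTE ne_ji) mulr0.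
exists (fun r => Reduced (gP r)) => [p|r]; last first.
  by apply/rowP => i; rewrite mxE /= g_coef.
apply/val_inj/mpolyP => mon /=.
have outside (q : {mpoly F[m]}) : q \in reduced_mpoly ->
    ~~ reduced_monom mon -> q@_mon = 0.
  rewrite reduced_mpolyE => /allP Hq Hmon; apply/eqP; rewrite mcoeff_eq0.
  by apply: contra Hmon => /Hq.
have [Hmon|Hmon] := boolP (reduced_monom mon); last first.
  by rewrite !outside //; case: p.
have lt_i : (index mon mons < size mons)%N by rewrite index_mem mem_mons.
have -> : mon = mon_of (Ordinal lt_i) by rewrite /mon_of nth_index ?mem_mons.
by rewrite g_coef mxE.
Qed.

HB.instance Definition _ := Lmodule_hasFinDim.Build F reduced reduced_vect_axiom.

End ReducedPolynomials.

Arguments reduced F [m] d e.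

Section AffineCartesianCode.

Variables (F : finFieldType) (m : nat) (d : 'I_m -> nat) (e n : nat).
Variable P : n.-tuple {dffun forall _ : 'I_m, F}.

Definition ev (f : reduced F d e) : 'rV[F]_n :=
  \row_i (f : {mpoly F[m]}).@[tnth P i].

Lemma ev_is_linear : linear ev.
Proof. by move=> c f g; apply/rowP => i; rewrite !mxE /= mevalD mevalZ. Qed.

HB.instance Definition _ :=
  GRing.isLinear.Build F (reduced F d e) 'rV[F]_n _ ev ev_is_linear.

Definition cartesian_code : {vspace 'rV[F]_n} := limg (linfun ev).

Lemma cartesian_codeP (c : 'rV[F]_n) :
  c \in cartesian_code <->
  exists2 f : {mpoly F[m]},
    f \in reduced_mpoly d e & c = \row_i f.@[tnth P i].
Proof.
split=> [/memv_imgP[f _ ->]|[f Hf ->]].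
  by exists (f : {mpoly F[m]}); [case: f | rewrite lfunE].
by apply/memv_imgP; exists (Reduced Hf); rewrite ?memvf // lfunE.
Qed.

End AffineCartesianCode.

Arguments cartesian_code {F m} d e {n} P.

Section VspaceFinite.

Import VectorInternalTheory.

Variables (F : finFieldType) (vT : vectType F).

HB.instance Definition _ := [Countable of {vspace vT} by <:].
HB.instance Definition _ := [Finite of {vspace vT} by <:].

End VspaceFinite.

Section GeneralizedHammingWeight.

Variables (F : finFieldType) (n : nat).

Definition supp (D : {vspace 'rV[F]_n}) : {set 'I_n} :=
  [set i | [exists c : 'rV[F]_n, (c \in D) && (c 0 i != 0)]].

(* The default value n is irrelevant when 1 <= r <= \dim C: see [ghw_min]. *)
Definition ghw (r : nat) (C : {vspace 'rV[F]_n}) : nat :=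
  \big[minn/n]_(D : {vspace 'rV[F]_n} | (D <= C)%VS && (\dim D == r)) #|supp D|.

Lemma ghw_le r (C D : {vspace 'rV[F]_n}) :
  (D <= C)%VS -> \dim D = r -> (ghw r C <= #|supp D|)%N.
Proof.
move=> sDC dimD; rewrite /ghw.
have : D \in index_enum {vspace 'rV[F]_n} by rewrite mem_index_enum.
elim: (index_enum _) => //= D' s IHs; rewrite in_cons big_cons.
case/predU1P => [<-|/IHs le_s]; first by rewrite sDC dimD eqxx geq_minl.
by case: ifP => // _; apply: leq_trans (geq_minr _ _) le_s.
Qed.

Lemma ghw_min r (C : {vspace 'rV[F]_n}) : (r <= \dim C)%N ->
  exists D : {vspace 'rV[F]_n},
    [/\ (D <= C)%VS, \dim D = r & #|supp D| = ghw r C].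
Proof.
move=> le_r.
have [D0 sD0 dimD0] : exists2 D : {vspace 'rV[F]_n}, (D <= C)%VS & \dim D = r.
  have C_basis := vbasisP C.
  exists <<take r (vbasis C)>>%VS.
    by apply/span_subvP => v /mem_take; apply: vbasis_mem.
  have fC : free (take r (vbasis C)).
    by have := basis_free C_basis; rewrite -{1}(cat_take_drop r (vbasis C)) => /catl_free.
  by move/eqP: fC => ->; rewrite size_takel // size_tuple.
have [[D [sD dimD Dw]]|ghw_n] :
    (exists D : {vspace 'rV[F]_n},
       [/\ (D <= C)%VS, \dim D = r & #|supp D| = ghw r C]) \/ ghw r C = n.
- rewrite /ghw; elim/big_ind: _ => [|x y Hx Hy|D /andP[sD /eqP dimD]].
  + by right.
  + by case: (leqP x y).
  + by left; exists D.
- by exists D.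
exists D0; split=> //; apply/eqP; rewrite eqn_leq ghw_le // ghw_n andbT.
by rewrite -[X in (_ <= X)%N](card_ord n) max_card.
Qed.

End GeneralizedHammingWeight.

Section LexicographicOrder.

Variables (m : nat) (d : 'I_m -> nat).

Definition box := {dffun forall i : 'I_m, 'I_(d i)}.

Definition box_ge (u : nat) : {set box} := [set a : box | u <= \sum_i a i]%N.

Definition lex_lt (a b : box) : bool :=
  [exists i : 'I_m,
     (a i < b i)%N && [forall j : 'I_m, (j < i)%N ==> (a j == b j)]].

Definition lex_le (a b : box) : bool := (a == b) || lex_lt a b.

Lemma lex_le_total : total lex_le.
Proof.
move=> a b; rewrite /lex_le; case: (eqVneq a b) => //= ne_ab.
have [i0 Hi0] : exists i, a i != b i.
  apply/existsP; apply: contraNT ne_ab; rewrite negb_exists => /forallP H.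
  by apply/eqP/ffunP => i; apply/eqP; rewrite -[_ == _]negbK.
case: (@arg_minnP _ i0 (fun i => a i != b i) (fun i => i : nat) Hi0) => i Hi mini.
have Heq (j : 'I_m) : (j < i)%N -> a j = b j.
  move=> lt_ji; apply/eqP; apply: contraTT lt_ji => /mini.
  by rewrite -leqNgt.
apply/orP; case: (ltngtP (a i) (b i)) => [lt|lt|/val_inj eq].
- left; apply/existsP; exists i; rewrite lt /=.
  by apply/forallP => j; apply/implyP => /Heq ->.
- right; apply/existsP; exists i; rewrite lt /=.
  by apply/forallP => j; apply/implyP => /Heq ->.
- by rewrite eq eqxx in Hi.
Qed.

Lemma lex_lt_trans : transitive lex_lt.
Proof.
move=> b a c /existsP[i /andP[lt_i /forallP eq_i]].
move=> /existsP[j /andP[lt_j /forallP eq_j]]; apply/existsP.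
case: (ltngtP i j) => [lt_ij|lt_ji|/val_inj eq_ij].
- exists i; have /implyP/(_ lt_ij)/eqP <- := eq_j i; rewrite lt_i /=.
  apply/forallP => k; apply/implyP => lt_ki.
  have /implyP/(_ lt_ki)/eqP -> := eq_i k.
  by have /implyP/(_ (ltn_trans lt_ki lt_ij)) := eq_j k.
- exists j; have /implyP/(_ lt_ji)/eqP -> := eq_i j; rewrite lt_j /=.
  apply/forallP => k; apply/implyP => lt_kj.
  have /implyP/(_ (ltn_trans lt_kj lt_ji))/eqP -> := eq_i k.
  by have /implyP/(_ lt_kj) := eq_j k.
- subst j; exists i; rewrite (ltn_trans lt_i lt_j) /=.
  apply/forallP => k; apply/implyP => lt_ki.
  have /implyP/(_ lt_ki)/eqP -> := eq_i k.
  by have /implyP/(_ lt_ki) := eq_j k.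
Qed.

Lemma lex_lt_irr : irreflexive lex_lt.
Proof. by move=> a; apply/existsP => -[i]; rewrite ltnn. Qed.

Lemma lex_le_trans : transitive lex_le.
Proof.
move=> b a c /orP[/eqP -> //|lt_ab] /orP[/eqP <-|lt_bc]; apply/orP; right=> //.
exact: lex_lt_trans lt_ab lt_bc.
Qed.

Lemma lex_le_anti : antisymmetric lex_le.
Proof.
move=> a b /andP[/orP[/eqP //|lt_ab] /orP[/eqP //|lt_ba]].
by have := lex_lt_trans lt_ab lt_ba; rewrite lex_lt_irr.
Qed.

(* The r-th smallest element of S for r >= 1, if S has that many elements. *)
Definition lex_nth (S : {set box}) (r : nat) : option box :=
  onth (sort lex_le (enum S)) r.-1.

End LexicographicOrder.

(* Main.v *)
From HB Require Import structures.
Require Import Defs.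
From mathcomp Require Import all_boot all_order all_algebra all_field.
From mathcomp Require Import mpoly.
From mathcomp Require Import zify ring.

(** Let M be the box of exponents, k the sum of all d_i - 1, and u = k - e.

    The code lives in the space of functions on the grid, and a basis adapted to
    it is the Newton basis: [newton a] is the product of the x_i - alpha_ij over
    all i and all j > a_i, where alpha_i0, alpha_i1, ... are the elements of A_i.
    It has degree k - sum_i a_i, and it is nonzero exactly at the grid points
    whose index vector is <= a coordinatewise.  The code is spanned by the
    [newton a] with sum_i a_i >= u ([newton_in_code], [ncoef_code]).

    Upper bound.  The span of [newton a] for the first r elements a of M_(>= u)
    has dimension r.  A point <= a coordinatewise is also lexicographically <= a,
    so the support of this span lies in the lexicographic initial segment that
    ends with the r-th element, whose size is the right-hand side.

    Lower bound.  Let D be a subspace of the code of dimension r and V the space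
    of all functions supported on supp D.  Call the lexicographically smallest
    index in the Newton expansion of a function its lead.  A subspace has as many
    leads as its dimension ([card_leads]).  Hence D has r leads, all in M_(>= u),
    and V has at most |supp D| leads.  As V is stable under multiplication by any
    x_i - c, which can lower a lead by one in the i-th coordinate ([lead_mulx]),
    the leads of V form a downset L of M containing the leads of D.

    It remains to see that a downset L with r elements of degree at least u has at
    least as many elements as the initial segment ending with the r-th element of
    M_(>= u).  This is a form of the theorem of Clements and Lindstrom
    ([lex_optimal_sorted]): among downsets of a given size, the initial segment has
    the most elements of degree >= u, provided that d_1 <= ... <= d_m.  It is proved
    by induction on the dimension.  In dimension two a downset is a staircase, and
    one argues on row lengths ([staircase_maximal_fill]).  In dimension at least
    three one compresses the slices with fixed first or fixed last coordinate, by
    induction, until the set no longer changes; a set compressed in both directions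
    is so close to an initial segment that the comparison is immediate
    ([compressed_gap], [lex_optimal_step]). *)

Set Implicit Arguments.
Unset Strict Implicit.
Unset Printing Implicit Defensive.

(** * Subsets of an interval and initial segments *)

Lemma sum_pred_le n (S : pred nat) : \sum_(x < n) S x <= n.
Proof.
rewrite -[leqRHS]card_ord -sum1_card; apply: leq_sum => i _; exact: leq_b1.
Qed.

Lemma sum_pairs (p q : nat) (f : nat -> nat) :
  \sum_(x < p * q) f x = \sum_(c < p) \sum_(y < q) f (c * q + y).
Proof.
elim: p => [|p IH]; first by rewrite mul0n !big_ord0.
rewrite mulSnr big_split_ord /= IH [RHS]big_ord_recr /=.
by congr (_ + _); apply: eq_bigr.
Qed.

Lemma sum_initial (n t : nat) (f : nat -> nat) : t <= n ->
  \sum_(x < n) (x < t) * f x = \sum_(x < t) f x.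
Proof.
move=> le_tn; rewrite (big_ord_widen n f le_tn) [RHS]big_mkcond /=.
by apply: eq_bigr => i _; case: ifP; rewrite ?mul1n ?mul0n.
Qed.

Definition initial n (S : pred nat) : bool :=
  [forall x : 'I_n, [forall y : 'I_n, (x < y) ==> S y ==> S x]].

Lemma initialP n (S : pred nat) :
  reflect (forall x y, x < y -> y < n -> S y -> S x) (initial n S).
Proof.
apply: (iffP idP) => [H x y lt_xy lt_yn Sy|H].
  have /forallP/(_ (Ordinal lt_yn)) := forallP H (Ordinal (ltn_trans lt_xy lt_yn)).
  by rewrite /= lt_xy Sy.
apply/forallP => x; apply/forallP => y.
by apply/implyP => lt_xy; apply/implyP; apply: H.
Qed.

Lemma sum_pred_lt n (S : pred nat) x : x < n -> ~~ S x -> \sum_(y < n) S y < n.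
Proof.
move=> lt_xn Sx; rewrite (bigD1 (Ordinal lt_xn)) //= (negbTE Sx) add0n.
have le_C : \sum_(y < n | y != Ordinal lt_xn) S y <= \sum_(y < n | y != Ordinal lt_xn) 1.
  by apply: leq_sum => y _; apply: leq_b1.
by apply: leq_ltn_trans le_C _; rewrite sum1_card cardC1 card_ord prednK //; lia.
Qed.

(** Since [initial] says that [S] has no gaps, it is determined by its size. *)
Lemma initial_size n (S : pred nat) x : initial n S -> x < n ->
  S x = (x < \sum_(y < n) S y).
Proof.
elim: n x => // n IH x /initialP iS; rewrite ltnS => le_xn.
have iSn : initial n S by apply/initialP => y z lt_yz lt_zn; apply: iS => //; lia.
rewrite big_ord_recr /=; case Sn: (S n).
  have -> : \sum_(y < n) S y = n.
    by rewrite -[RHS]card_ord -sum1_card; apply: eq_bigr => y _; rewrite (iS y n).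
  rewrite addn1 ltnS le_xn; move: le_xn; rewrite leq_eqVlt => /predU1P[-> //|lt_xn].
  exact: iS Sn.
rewrite addn0; move: le_xn; rewrite leq_eqVlt => /predU1P[->|]; last exact: IH.
by rewrite Sn ltnNge sum_pred_le.
Qed.

(** Pushing [S] down onto an initial segment of the same size lowers every
    increasing weight, and strictly so unless nothing moves.  This is what makes
    the compressions below terminate. *)
Lemma sum_initial_leqif n (S : pred nat) (g : nat -> nat) :
    (forall x y, x < y -> g x < g y) ->
  \sum_(x < \sum_(y < n) S y) g x <= \sum_(x < n) S x * g x ?= iff initial n S.
Proof.
move=> g_mono; have g_le x y : x <= y -> g x <= g y.
  by rewrite leq_eqVlt => /predU1P[-> //|/g_mono/ltnW].
elim: n => [|n IH].
  by rewrite !big_ord0; split=> //; apply/esym/initialP.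
have -> : initial n.+1 S = initial n S && (S n ==> (\sum_(x < n) S x == n)).
  apply/idP/andP => [iS|[/initialP iS Hn]].
    split; first by apply/initialP => x y ? ?; apply: (initialP _ _ iS); lia.
    apply/implyP => Sn; apply/eqP; rewrite -[RHS]card_ord -sum1_card.
    by apply: eq_bigr => x _; rewrite (initialP _ _ iS x n).
  apply/initialP => x y lt_xy; rewrite ltnS leq_eqVlt.
  case/predU1P => [eq_y|lt_yn]; last exact: iS.
  rewrite {y}eq_y in lt_xy * => Sn; apply: contraT => /(sum_pred_lt lt_xy).
  by rewrite (eqP (implyP Hn Sn)) ltnn.
rewrite !big_ord_recr /=; case: (S n); last by rewrite addn0 mul0n addn0 andbT.
rewrite addn1 mul1n big_ord_recr /=; apply: leqif_add => //.
have le_n := sum_pred_le n S; split; first exact: g_le.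
by case: ltngtP le_n => // [/g_mono lt_g _|->]; rewrite ?eqxx // ltn_eqF.
Qed.

(** Passing from [S] to the initial segment of the same size exchanges the
    elements of [S] above the threshold for as many gaps of [S] below it.  If [g]
    holds at one of the former, then by hypothesis it holds at all of the
    latter. *)
Lemma initial_count n (S g : pred nat) :
    (forall x y, x < y -> y < n -> S y -> ~~ S x -> g y -> g x) ->
  \sum_(x < n) (S x && g x) <= \sum_(x < \sum_(y < n) S y) g x.
Proof.
move=> S_g; set t := \sum_(y < n) S y.
have le_tn : t <= n by apply: sum_pred_le.
rewrite -(sum_initial (fun x => g x : nat) le_tn).
(* common part, gaps below the threshold, elements above it *)
pose I x := (x < t) && S x; pose L x := (x < t) && ~~ S x.
pose R x := (t <= x) && S x.
have cLR : \sum_(x < n) L x = \sum_(x < n) R x.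
  apply/eqP; rewrite -(eqn_add2l (\sum_(x < n) I x)) -!big_split /=; apply/eqP.
  rewrite [LHS](eq_bigr (fun x : 'I_n => (x < t) * 1)); last first.
    by move=> x _; rewrite /I /L; case: (x < t); case: (S x).
  rewrite (sum_initial (fun=> 1)) // sum_nat_const card_ord muln1 /t.
  by apply: eq_bigr => x _; rewrite /I /R; case: ltnP; case: (S x).
rewrite (eq_bigr (fun x : 'I_n => (I x && g x) + (R x && g x))); last first.
  by move=> x _; rewrite /I /R; case: ltnP; case: (S x); case: (g x).
rewrite [leqRHS](eq_bigr (fun x : 'I_n => (I x && g x) + (L x && g x))); last first.
  by move=> x _; rewrite /I /L; case: ltnP; case: (S x); case: (g x).
rewrite !big_split leq_add2l /=.
have [/existsP[y /andP[/andP[le_ty Sy] gy]]|/existsPn no_y] :=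
    boolP [exists y : 'I_n, R y && g y]; last first.
  by rewrite big1 // => x _; rewrite (negbTE (no_y x)).
rewrite [leqRHS](eq_bigr (fun x : 'I_n => L x : nat)); last first.
  move=> x _; case Lx: (L x) => //=; case/andP: Lx => lt_xt Sx.
  by rewrite (S_g x y) //; apply: leq_trans le_ty.
by rewrite cLR; apply: leq_sum => x _; case: (R x); case: (g x).
Qed.

(** * Staircases in a rectangle *)

(** A downset of the rectangle a x b is given by its row lengths [l]. *)
Definition staircase a b (l : nat -> nat) :=
  (forall c, c < a -> l c <= b) /\ (forall c c', c <= c' < a -> l c' <= l c).
Definition area a (l : nat -> nat) := \sum_(c < a) l c.
(** The number of cells (c, y), y < l c, with u <= c + y: the truncated
    subtraction [l c - (u - c)] counts those of row c. *)
Definition cells a (l : nat -> nat) u := \sum_(c < a) (l c - (u - c)).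
(** The row lengths of the first t cells in lexicographic order. *)
Definition row_fill b t (c : nat) := minn b (t - c * b).

Lemma cellsSl a l u : cells a.+1 l u = l 0 - u + cells a (fun c => l c.+1) (u - 1).
Proof.
rewrite /cells big_ord_recl /= subn0; congr (_ + _).
by apply: eq_bigr => c _; congr (_ - _); rewrite /bump /=; lia.
Qed.

Lemma areaSl a l : area a.+1 l = l 0 + area a (fun c => l c.+1).
Proof. by rewrite /area big_ord_recl. Qed.

Lemma eq_cells a l l' u : (forall c, c < a -> l c = l' c) -> cells a l u = cells a l' u.
Proof. by move=> eq_l; apply: eq_bigr => c _; rewrite eq_l. Qed.

Lemma eq_area a l l' : (forall c, c < a -> l c = l' c) -> area a l = area a l'.
Proof. by move=> eq_l; apply: eq_bigr => c _; rewrite eq_l. Qed.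

Lemma fillS b t c : row_fill b t c.+1 = row_fill b (t - b) c.
Proof. by rewrite /row_fill mulSn subnDA. Qed.

Lemma area_fill a b t : t <= a * b -> area a (row_fill b t) = t.
Proof.
elim: a t => [|a IH] t le_t; first by rewrite /area big_ord0; lia.
rewrite areaSl (eq_area (fun c _ => fillS b t c)) IH /row_fill; lia.
Qed.

Lemma staircase_fill a b t : staircase a b (row_fill b t).
Proof.
split=> [c _|c c' /andP[le_c _]]; rewrite /row_fill; first exact: geq_minl.
have := leq_mul le_c (leqnn b); lia.
Qed.

Lemma area_le a b l : staircase a b l -> area a l <= a * b.
Proof.
case=> le_b _; rewrite -[a in leqRHS]card_ord -sum_nat_const.
by apply: leq_sum => c _; apply: le_b.
Qed.

Definition conj_rows a (l : nat -> nat) y := \sum_(c < a) (y < l c).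

(** Row c reaches column y exactly when column y reaches row c, because the
    rows are decreasing. *)
Lemma conj_rowsE a b l c y : staircase a b l -> c < a ->
  (c < conj_rows a l y) = (y < l c).
Proof.
move=> [_ l_dec] lt_ca; rewrite /conj_rows.
rewrite -(@initial_size a (fun c => y < l c)) //.
apply/initialP => x z lt_xz lt_za lt_y; apply: leq_trans lt_y _; apply: l_dec.
by rewrite (ltnW lt_xz).
Qed.

Lemma row_cells b n v : n <= b -> \sum_(y < b) ((y < n) && (v <= y)) = n - v.
Proof.
elim: b n => [|b IH] n le_n; first by rewrite big_ord0; lia.
rewrite big_ord_recr /=; case: (ltngtP n b.+1) le_n => // [lt_n|->] _.
  by rewrite IH //; lia.
rewrite (eq_bigr (fun y : 'I_b => (y < b) && (v <= y) : nat)); last first.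
  by move=> y _; rewrite ltn_ord ltnS ltnW.
rewrite IH //; lia.
Qed.

Lemma cellsE a b l u : (forall c, c < a -> l c <= b) ->
  cells a l u = \sum_(c < a) \sum_(y < b) ((y < l c) && (u <= c + y)).
Proof.
move=> le_b; apply: eq_bigr => c _; rewrite -(row_cells _ (le_b c (ltn_ord c))).
by apply: eq_bigr => y _; congr (nat_of_bool (_ && _)); lia.
Qed.

Lemma conj_rows_le a l y : conj_rows a l y <= a.
Proof. exact: (sum_pred_le a (fun c => y < l c)). Qed.

(** Transposing preserves c + y, hence the number of cells on or above each
    antidiagonal. *)
Lemma cells_conj a b l u : staircase a b l -> cells b (conj_rows a l) u = cells a l u.
Proof.
move=> st; rewrite (cellsE _ st.1) (@cellsE b a); last by move=> *; apply: conj_rows_le.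
rewrite exchange_big; apply: eq_bigr => c _; apply: eq_bigr => y _.
by rewrite (conj_rowsE y st) // addnC.
Qed.

Lemma staircase_conj a b l : staircase b a (conj_rows a l).
Proof.
split=> [y _|y y' /andP[le_y _]]; first exact: conj_rows_le.
by apply: leq_sum => c _; lia.
Qed.

Lemma cells0 a l : cells a l 0 = area a l.
Proof. by apply: eq_bigr => c _; rewrite subn0. Qed.

Lemma area_conj a b l : staircase a b l -> area b (conj_rows a l) = area a l.
Proof. by move=> st; rewrite -!cells0 (cells_conj _ st). Qed.

Definition maximal_fill a b := forall l u, staircase a b l ->
  cells a l u <= cells a (row_fill b (area a l)) u.

(** A full first row is shared with the filling of the same area, so both may be
    dropped; the remaining cells lose one unit of degree. *)
Lemma maximal_fill_head a b l u : maximal_fill a b -> staircase a.+1 b l -> l 0 = b ->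
  cells a.+1 l u <= cells a.+1 (row_fill b (area a.+1 l)) u.
Proof.
move=> IH [le_b l_dec] l0; rewrite !cellsSl areaSl l0.
rewrite (eq_cells _ (fun c _ => fillS b _ c)) addKn.
rewrite leq_add //; first by rewrite leq_sub2r // /row_fill; lia.
by apply: IH; split=> [c ?|c c' ?]; [apply: le_b|apply: l_dec]; lia.
Qed.

Lemma maximal_fill_last a b l u : maximal_fill a b -> staircase a.+1 b l -> l a = 0 ->
  cells a.+1 l u <= cells a.+1 (row_fill b (area a.+1 l)) u.
Proof.
move=> IH [le_b l_dec] la; rewrite /cells /area !big_ord_recr /= la sub0n !addn0.
apply: leq_trans (leq_addr _ _); apply: IH.
by split=> [c ?|c c' ?]; [apply: le_b|apply: l_dec]; lia.
Qed.

(** In a rectangle of width b.+1 with column b empty, all rows but the last being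
    otherwise full, the min s a rightmost cells of the last row are moved into
    column b.  Their degrees before and after form two runs of consecutive
    integers of the same length, and the new run starts no lower than the old:
    at b, instead of at a if s <= a and at s otherwise. *)
Lemma cells_move a b s u : a <= b -> s <= b ->
  cells a.+1 (fun c => if c < a then b else s) u
    <= cells a.+1 (fun c => if c < a then b + (c < s) else s - a) u.
Proof.
move=> le_ab le_sb; rewrite /cells !big_ord_recr /= !ltnn.
rewrite [leqRHS]addnC.
rewrite [X in _ <= _ + X](eq_bigr (fun c : 'I_a =>
  ((if c < a then b else s) - (u - c)) + ((c < minn s a) && (u - b <= c)))); last first.
  by move=> c _; have lt_c := ltn_ord c; rewrite lt_c; lia.
rewrite big_split /= row_cells; last exact: geq_minr.
rewrite addnCA leq_add2l; lia.
Qed.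

(** The two-dimensional case of the theorem of Clements and Lindstrom.  An empty
    last row or a full first row reduces the number of rows.  Otherwise, in a
    square the first column is full and one transposes; if a < b the shape avoids
    the last column, so that one may fill the narrower rectangle instead, and then
    move cells from the last row to the last column until one of the first two
    cases applies. *)
Lemma staircase_maximal_fill a b : a <= b -> maximal_fill a b.
Proof.
elim: b a => [|b IHb] a.
  rewrite leqn0 => /eqP-> l u _; by rewrite /cells !big_ord0.
elim: a => [|a IHa] le_ab l u st; first by rewrite /cells !big_ord0.
have {}IHa : maximal_fill a b.+1 by apply: IHa; lia.
have [l0|l0] := eqVneq (l 0) b.+1; first exact: maximal_fill_head.
have [la|la] := eqVneq (l a) 0; first exact: maximal_fill_last.
have [eq_ab|ne_ab] := eqVneq a b.
  subst b.
  rewrite -(cells_conj u st) -(area_conj st).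
  apply: (maximal_fill_head _ IHa (staircase_conj a.+1 a.+1 l)).
  apply/eqP; rewrite eqn_leq conj_rows_le.
  rewrite (conj_rowsE 0 st) //; lia.
have [le_b l_dec] := st.
have stb : staircase a.+1 b l.
  split=> // c lt_c; have := l_dec 0 c; have := le_b 0; lia.
(* replace l by the filling of the rectangle of width b *)
have := IHb a.+1 _ l u stb; move=> /(_ ltac:(lia)) /leq_trans; apply.
have le_t := area_le stb; set t := area _ _ in le_t *.
have at_ : area a.+1 (row_fill b t) = t by apply: area_fill.
have [la'|la'] := eqVneq (row_fill b t a) 0.
  rewrite -{2}at_; apply: maximal_fill_last => //.
  by have [] := staircase_fill a.+1 b t => le_f ?; split=> // c /le_f; lia.
(* row a is nonempty, so all rows above it are filled up to b *)
have ab_lt : a * b < t by move: la'; rewrite /row_fill; lia.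
pose s := t - a * b.
have le_sb : s <= b by rewrite /s; lia.
pose l' c := if c < a then b + (c < s) else s - a.
have fillE c : c < a.+1 -> row_fill b t c = if c < a then b else s.
  rewrite ltnS leq_eqVlt /row_fill => /predU1P[->|lt_c].
    by rewrite ltnn; apply/minn_idPr; rewrite -/s; lia.
  rewrite lt_c; apply/minn_idPl.
  have : c.+1 * b <= a * b by rewrite leq_mul2r lt_c orbT.
  lia.
rewrite (eq_cells _ fillE).
apply: leq_trans (cells_move u _ le_sb) _; first lia.
rewrite -/l'.
have al' : area a.+1 l' = t.
  rewrite /area big_ord_recr /= /l' ltnn (eq_bigr (fun c : 'I_a => b + (c < s))); last first.
    by move=> c _; rewrite ltn_ord.
  rewrite big_split /= sum_nat_const card_ord.
  rewrite (eq_bigr (fun c : 'I_a => (c < minn s a) && (0 <= c) : nat)); last first.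
    by move=> c _; have := ltn_ord c; lia.
  rewrite row_cells ?geq_minr //; rewrite /s; lia.
rewrite -al'; have [a0|a_gt0] := posnP a.
  rewrite a0 /cells !big_ord_recl !big_ord0 /row_fill /area !big_ord_recl big_ord0 /=.
  rewrite /l' a0 /=; lia.
apply: maximal_fill_head => //; last by rewrite /l' a_gt0 /s; lia.
split=> [c|c c' /andP[le_c lt_c']]; rewrite /l'; first by case: ifP; lia.
by case: (ltnP c a); case: (ltnP c' a); lia.
Qed.

(** * Boxes in mixed radix *)

(** A point of the box with side lengths [ds] is encoded by the integer whose
    mixed radix expansion, most significant digit first, lists its coordinates.
    Lexicographic order becomes the order of integers, and the initial segments
    of the lexicographic order become the intervals [0, t). *)
Definition vol (ds : seq nat) := \prod_(d <- ds) d.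

Fixpoint digit_sum (ds : seq nat) x :=
  if ds is _ :: ds' then x %/ vol ds' + digit_sum ds' (x %% vol ds') else 0.

(** The coordinatewise order on codes.  The base case, where both arguments should
    be 0, makes it a suborder of [<=] without any bound on the arguments. *)
Fixpoint digit_le (ds : seq nat) x y :=
  if ds is _ :: ds' then
    (x %/ vol ds' <= y %/ vol ds') && digit_le ds' (x %% vol ds') (y %% vol ds')
  else x <= y.

Lemma vol_nil : vol [::] = 1. Proof. exact: big_nil. Qed.

Lemma vol_cons d ds : vol (d :: ds) = d * vol ds.
Proof. exact: big_cons. Qed.

Lemma vol_rcons ds b : vol (rcons ds b) = vol ds * b.
Proof. by rewrite /vol -cats1 big_cat big_seq1. Qed.

Lemma divn_pair q c y : y < q -> (c * q + y) %/ q = c.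
Proof. by move=> lt_y; rewrite divnMDl ?divn_small ?addn0 //; lia. Qed.

Lemma modn_pair q c y : y < q -> (c * q + y) %% q = y.
Proof. by move=> lt_y; rewrite modnMDl modn_small. Qed.

Lemma digit_sum_cons d ds c w : w < vol ds ->
  digit_sum (d :: ds) (c * vol ds + w) = c + digit_sum ds w.
Proof. by move=> lt_w; rewrite /= divn_pair // modn_pair. Qed.

Lemma digit_le_cons d ds c c' w w' : w < vol ds -> w' < vol ds ->
  digit_le (d :: ds) (c * vol ds + w) (c' * vol ds + w') = (c <= c') && digit_le ds w w'.
Proof. by move=> lt_w lt_w'; rewrite /= !divn_pair // !modn_pair. Qed.

Lemma pair_lt p q c y : c < p -> y < q -> c * q + y < p * q.
Proof. by move=> lt_c lt_y; have := leq_mul lt_c (leqnn q); lia. Qed.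

Lemma pairP p q x : x < p * q -> exists c y, [/\ c < p, y < q & x = c * q + y].
Proof.
case: (posnP q) => [-> | q_gt0 lt_x]; first by rewrite muln0.
exists (x %/ q), (x %% q); rewrite ltn_divLR // ltn_mod; split=> //; exact: divn_eq.
Qed.

Lemma digit_sum_rcons ds b v y : v < vol ds -> y < b ->
  digit_sum (rcons ds b) (v * b + y) = digit_sum ds v + y.
Proof.
elim: ds v => [|d ds IH] v.
  by rewrite vol_nil; case: v => //= _ _; rewrite vol_nil divn1 addn0.
rewrite vol_cons => /pairP[c [w [lt_c lt_w ->]]] lt_y; rewrite digit_sum_cons // rcons_cons.
have -> : (c * vol ds + w) * b + y = c * vol (rcons ds b) + (w * b + y).
  by rewrite vol_rcons mulnDl -mulnA addnA.
rewrite digit_sum_cons; last by rewrite vol_rcons pair_lt.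
by rewrite IH // addnA.
Qed.

Lemma digit_le_rcons ds b v v' y y' : v < vol ds -> v' < vol ds -> y < b -> y' < b ->
  digit_le (rcons ds b) (v * b + y) (v' * b + y') = digit_le ds v v' && (y <= y').
Proof.
move=> + + lt_y lt_y'; elim: ds v v' => [|d ds IH] v v'.
  rewrite vol_nil; case: v => //; case: v' => //= _ _.
  by rewrite vol_nil !divn1 !modn1 andbT.
rewrite vol_cons => /pairP[c [w [lt_c lt_w ->]]] /pairP[c' [w' [lt_c' lt_w' ->]]].
have E z e k : (z * vol ds + e) * b + k = z * vol (rcons ds b) + (e * b + k).
  by rewrite vol_rcons mulnDl -mulnA addnA.
rewrite digit_le_cons // rcons_cons !E digit_le_cons ?IH ?andbA //.
- by rewrite vol_rcons pair_lt.
- by rewrite vol_rcons pair_lt.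
Qed.

Lemma digit_le_leq ds x y : digit_le ds x y -> x <= y.
Proof.
elim: ds x y => //= d ds IH x y /andP[le_q /IH le_r].
by rewrite (divn_eq x (vol ds)) (divn_eq y (vol ds)) leq_add // leq_mul.
Qed.

Lemma digit_le_refl ds x : digit_le ds x x.
Proof. by elim: ds x => //= d ds IH x; rewrite leqnn IH. Qed.

Lemma digit_sum0 ds : digit_sum ds 0 = 0.
Proof. by elim: ds => //= d ds IH; rewrite div0n mod0n IH. Qed.

Definition downset ds (T : pred nat) :=
  forall x y, x < vol ds -> y < vol ds -> digit_le ds x y -> T y -> T x.

Definition lex_optimal ds := forall (T : pred nat) u, downset ds T ->
  \sum_(x < vol ds) (T x && (u <= digit_sum ds x))
    <= \sum_(x < \sum_(y < vol ds) T y) (u <= digit_sum ds x).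

Lemma initial_optimal n (T g : pred nat) : initial n T ->
  \sum_(x < n) (T x && g x) <= \sum_(x < \sum_(y < n) T y) g x.
Proof.
by move=> /initialP iT; apply: initial_count => x y lt_xy lt_yn /(iT _ _ lt_xy lt_yn) ->.
Qed.

Lemma lex_optimal_nil : lex_optimal [::].
Proof.
move=> T u _; apply: (@initial_optimal _ T (fun x => u <= digit_sum _ x)).
apply/initialP => x y.
by rewrite vol_nil; case: y.
Qed.

Lemma lex_optimal1 a : lex_optimal [:: a].
Proof.
move=> T u dT; apply: (@initial_optimal _ T (fun x => u <= digit_sum _ x)).
apply/initialP => x y lt_xy lt_y.
apply: (dT x y _ lt_y) => //; first exact: ltn_trans lt_xy lt_y.
by rewrite /= vol_nil !divn1 !modn1 ltnW.
Qed.

Lemma vol1 a : vol [:: a] = a. Proof. exact: big_seq1. Qed.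

Lemma digit_sum2 a b c y : y < b -> digit_sum [:: a; b] (c * b + y) = c + y.
Proof.
have := @digit_sum_cons a [:: b] c y; rewrite vol1 => /[apply] ->.
by rewrite /= vol_nil divn1 addn0.
Qed.

Lemma digit_le2 a b c c' y y' : y < b -> y' < b ->
  digit_le [:: a; b] (c * b + y) (c' * b + y') = (c <= c') && (y <= y').
Proof.
have := @digit_le_cons a [:: b] c c' y y'; rewrite vol1 => /[apply]/[apply] ->.
by rewrite /= vol_nil !divn1 !modn1 andbT.
Qed.

Lemma lex_optimal2 a b : a <= b -> lex_optimal [:: a; b].
Proof.
move=> le_ab T u; rewrite /downset vol_cons vol1 => dT.
pose l c := \sum_(y < b) T (c * b + y).
have st : staircase a b l.
  split=> [c _|c c' /andP[le_c lt_c']]; first exact: (sum_pred_le b (fun y => T (c * b + y))).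
  apply: leq_sum => y _; case E: (T (c' * b + y)) => //.
  by rewrite (dT _ _ _ _ _ E) ?digit_le2 ?le_c ?pair_lt //; lia.
have -> : \sum_(x < a * b) T x = area a l by rewrite (sum_pairs a b T).
have -> : \sum_(x < a * b) (T x && (u <= digit_sum [:: a; b] x)) = cells a l u.
  rewrite (sum_pairs a b (fun x => T x && (u <= digit_sum [:: a; b] x))) (cellsE _ st.1).
  apply: eq_bigr => c _; apply: eq_bigr => y _; rewrite digit_sum2 // /l.
  rewrite -(@initial_size b (fun y => T (c * b + y))) //.
  apply/initialP => z z' lt_z lt_z'; apply: dT; rewrite ?digit_le2 ?pair_lt //; lia.
have le_t := area_le st.
apply: leq_trans (staircase_maximal_fill le_ab u st) _.
rewrite (cellsE _ (staircase_fill a b (area a l)).1).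
rewrite -(sum_initial (fun x => u <= digit_sum [:: a; b] x : nat) le_t).
rewrite (sum_pairs a b (fun x => (x < _) * (u <= digit_sum [:: a; b] x))).
apply: leq_sum => c _; apply: leq_sum => y _; rewrite digit_sum2 //.
rewrite mulnb /row_fill; have := ltn_ord y; lia.
Qed.

(** * Compression and the theorem of Clements and Lindstrom *)

Section Compression.
Variables (p q : nat) (T : nat -> nat -> bool).
Let l c := \sum_(y < q) T c y.

Lemma compress_size c : \sum_(y < q) (y < l c) = l c.
Proof.
rewrite (eq_bigr (fun y : 'I_q => (y < l c) * 1)); last by move=> y _; rewrite muln1.
by rewrite (sum_initial (fun=> 1)) ?sum_pred_le // sum1_card card_ord.
Qed.

Lemma compress_weight (g : nat -> nat -> nat) :
    (forall c x y, x < y -> g c x < g c y) ->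
  \sum_(c < p) \sum_(y < q) (y < l c) * g c y
    <= \sum_(c < p) \sum_(y < q) T c y * g c y
    ?= iff [forall c : 'I_p, initial q (T c)].
Proof.
move=> g_mono; apply: leqif_sum => c _; rewrite sum_initial ?sum_pred_le //.
exact: (@sum_initial_leqif q (T c) (g c) (g_mono c)).
Qed.

End Compression.

Definition size_of ds (T : pred nat) := \sum_(x < vol ds) T x.
Definition high_part ds u (T : pred nat) :=
  \sum_(x < vol ds) (T x && (u <= digit_sum ds x)).
Definition code_sum ds (T : pred nat) := \sum_(x < vol ds) T x * x.

(** What a compression [T'] of a downset [T] achieves; [C] is the condition under
    which [T] was compressed already. *)
Definition compresses ds u (T T' : pred nat) C :=
  [/\ downset ds T', size_of ds T' = size_of ds T,
      high_part ds u T <= high_part ds u T'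
    & code_sum ds T' <= code_sum ds T ?= iff C].

(** If the box without its first coordinate is [lex_optimal], then each of
    the slices on which this coordinate is constant may be replaced by an initial
    segment of the same size.  The slices of a downset decrease, hence so do
    these segments, and the result is again a downset. *)
Lemma compress_first a ds u T (q := vol ds) : lex_optimal ds -> downset (a :: ds) T ->
  compresses (a :: ds) u T
    (fun x => x %% q < \sum_(y < q) T ((x %/ q) * q + y))
    [forall c : 'I_a, initial q (fun y => T (c * q + y))].
Proof.
move=> opt; rewrite /downset vol_cons -/q => dT.
pose l c := \sum_(y < q) T (c * q + y).
pose T' x := x %% q < l (x %/ q); rewrite -/T'.
have T'E c y : y < q -> T' (c * q + y) = (y < l c).
  by move=> lt_y; rewrite /T' modn_pair ?divn_pair.
rewrite /compresses /size_of /high_part /code_sum /downset !vol_cons -/q.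
have sumE := sum_pairs a q.
split.
- move=> _ _ /pairP[c [y [lt_c lt_y ->]]] /pairP[c' [y' [lt_c' lt_y' ->]]].
  rewrite digit_le_cons // !T'E // => /andP[le_c /digit_le_leq le_y] lt_l.
  apply: leq_ltn_trans le_y (leq_trans lt_l _).
  apply: leq_sum => z _; case E: (T (c' * q + z)) => //.
  by rewrite (dT _ _ _ _ _ E) ?digit_le_cons ?le_c ?digit_le_refl ?pair_lt.
- rewrite (sumE T) (sumE T'); apply: eq_bigr => c _.
  rewrite -(compress_size q (fun c y => T (c * q + y)) c).
  by apply: eq_bigr => y _; rewrite T'E.
- rewrite (sumE (fun x => T x && (u <= digit_sum (a :: ds) x)))
    (sumE (fun x => T' x && (u <= digit_sum (a :: ds) x))).
  apply: leq_sum => c _.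
  rewrite (eq_bigr (fun y : 'I_q => T (c * q + y) && (u - c <= digit_sum ds y) : nat)).
    have dTc : downset ds (fun y => T (c * q + y)).
      by move=> x y lt_x lt_y le_xy; apply: dT; rewrite ?digit_le_cons ?leqnn ?pair_lt.
    apply: leq_trans (opt _ (u - c) dTc) _.
    rewrite -(sum_initial (fun y => (u - c <= digit_sum ds y) : nat)
      (sum_pred_le q (fun y => T (c * q + y)))).
    apply: leq_sum => y _; rewrite T'E // digit_sum_cons // leq_subLR.
    by rewrite mulnb.
  by move=> y _; rewrite digit_sum_cons // leq_subLR.
- rewrite (sumE (fun x => T x * x)) (sumE (fun x => T' x * x)).
  have := @compress_weight a q (fun c y => T (c * q + y)) (fun c y => c * q + y).
  move=> /(_ (fun c x y lt_xy => ltac:(by rewrite ltn_add2l))).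
  congr (leqif _ _ _); apply: eq_bigr => c _; apply: eq_bigr => y _.
  by rewrite T'E.
Qed.

(** The same for the slices on which the last coordinate is constant. *)
Lemma compress_last ds b u T : lex_optimal ds -> downset (rcons ds b) T ->
  compresses (rcons ds b) u T
    (fun x => x %/ b < \sum_(v < vol ds) T (v * b + x %% b))
    [forall y : 'I_b, initial (vol ds) (fun v => T (v * b + y))].
Proof.
move=> opt; rewrite /downset vol_rcons => dT; set p := vol ds in dT *.
pose l y := \sum_(v < p) T (v * b + y).
pose T' x := x %/ b < l (x %% b); rewrite -/T'.
have T'E v y : y < b -> T' (v * b + y) = (v < l y).
  by move=> lt_y; rewrite /T' modn_pair ?divn_pair.
rewrite /compresses /size_of /high_part /code_sum /downset !vol_rcons -/p.
have sumE (f : nat -> nat) : \sum_(x < p * b) f x = \sum_(y < b) \sum_(v < p) f (v * b + y).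
  by rewrite sum_pairs exchange_big.
split.
- move=> _ _ /pairP[c [y [lt_c lt_y ->]]] /pairP[c' [y' [lt_c' lt_y' ->]]].
  rewrite digit_le_rcons // !T'E // => /andP[/digit_le_leq le_c le_y] lt_l.
  apply: leq_ltn_trans le_c (leq_trans lt_l _).
  apply: leq_sum => z _; case E: (T (z * b + y')) => //.
  by rewrite (dT _ _ _ _ _ E) ?digit_le_rcons ?le_y ?digit_le_refl ?pair_lt.
- rewrite (sumE T) (sumE T'); apply: eq_bigr => y _.
  rewrite -(compress_size p (fun y v => T (v * b + y)) y).
  by apply: eq_bigr => v _; rewrite T'E.
- rewrite (sumE (fun x => T x && (u <= digit_sum (rcons ds b) x)))
    (sumE (fun x => T' x && (u <= digit_sum (rcons ds b) x))).
  apply: leq_sum => y _.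
  rewrite (eq_bigr (fun v : 'I_p => T (v * b + y) && (u - y <= digit_sum ds v) : nat)).
    have dTc : downset ds (fun v => T (v * b + y)).
      by move=> x z lt_x lt_z le_xz; apply: dT; rewrite ?digit_le_rcons ?leqnn ?andbT ?pair_lt.
    apply: leq_trans (opt _ (u - y) dTc) _.
    rewrite -(sum_initial (fun v => (u - y <= digit_sum ds v) : nat)
      (sum_pred_le p (fun v => T (v * b + y)))).
    apply: leq_sum => v _; rewrite T'E // digit_sum_rcons // leq_subLR [y + _]addnC.
    by rewrite mulnb.
  by move=> v _; rewrite digit_sum_rcons // leq_subLR [y + _]addnC.
- rewrite (sumE (fun x => T x * x)) (sumE (fun x => T' x * x)).
  have := @compress_weight b p (fun y v => T (v * b + y)) (fun y v => v * b + y).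
  case: (posnP b) => [b0 _|b_gt0 wT].
    have no_y (y : 'I_b) : False by case: y => y; rewrite b0.
    rewrite !big1; try by move=> y; case: (no_y y).
    by split; last by apply/esym/forallP => y; case: (no_y y).
  have {wT} := wT (fun c x y lt_xy => ltac:(by rewrite ltn_add2r ltn_pmul2r)).
  congr (leqif _ _ _); apply: eq_bigr => c _; apply: eq_bigr => y _.
  by rewrite T'E.
Qed.

Section Compressed.
Variables (a h b : nat) (T : pred nat).
Hypothesis h1 : h = 1 -> a <= 1.
Hypothesis fix_first : forall c, c < a -> initial (h * b) (fun y => T (c * (h * b) + y)).
Hypothesis fix_last : forall y, y < b -> initial (a * h) (fun v => T (v * b + y)).

Let mk c v z := (c * h + v) * b + z.

(** Suppose that [T] is compressed in the first and in the last coordinate, and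
    that it misses x = (c, v, z) but contains the larger y = (c', v', z').  A
    point between x and y that shares an outer coordinate with x is not in [T],
    and one that shares an outer coordinate with y is in [T].  Unless x and y have
    the stated, nearly adjacent, position, there would be a point sharing one
    coordinate with each of them, or a point of the first kind below a point of
    the second kind with the same first coordinate; both are impossible. *)
Lemma compressed_gap c v z c' v' z' : c < a -> v < h -> z < b ->
    c' < a -> v' < h -> z' < b ->
    mk c v z < mk c' v' z' -> T (mk c' v' z') -> ~~ T (mk c v z) ->
  [/\ c' = c.+1, v = h.-1, v' = 0 & z' < z].
Proof.
move=> lt_c lt_v lt_z lt_c' lt_v' lt_z' lt_xy Ty /negP Tx.
have mkE e w k : mk e w k = e * (h * b) + (w * b + k).
  by rewrite /mk mulnDl mulnA addnA.
have first_down e w k w' k' : e < a -> w < h -> w' < h -> k < b -> k' < b ->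
    w' * b + k' < w * b + k -> T (mk e w k) -> T (mk e w' k').
  move=> lt_e lt_w lt_w' lt_k lt_k' lt; rewrite !mkE.
  by apply: (initialP _ _ (fix_first lt_e)); rewrite ?pair_lt.
have last_down e w k e' w' : e < a -> w < h -> e' < a -> w' < h -> k < b ->
    e' * h + w' < e * h + w -> T (mk e w k) -> T (mk e' w' k).
  move=> lt_e lt_w lt_e' lt_w' lt_k lt.
  by apply: (initialP _ _ (fix_last lt_k)); rewrite ?pair_lt.
have lt_pair q e e' w w' : w < q -> e < e' -> e * q + w < e' * q + w'.
  by move=> lt_w lt_e; have := leq_mul lt_e (leqnn q); lia.
have lt_cc' : c < c'.
  rewrite ltnNge; apply/negP; rewrite leq_eqVlt => /predU1P[eq_c|lt_c'c].
    apply: Tx; subst c'.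
    by apply: (first_down _ v' z') => //; move: lt_xy; rewrite !mkE; lia.
  have := lt_pair _ _ _ (v' * b + z') (v * b + z) (pair_lt lt_v' lt_z') lt_c'c.
  by move: lt_xy; rewrite !mkE; lia.
have lt_vv : c * h + v < c' * h + v' by apply: lt_pair.
have lt_z'z : z' < z.
  rewrite ltnNge; apply/negP; rewrite leq_eqVlt => /predU1P[eq_z|lt_zz'].
    by apply: Tx; rewrite eq_z; apply: (last_down c' v').
  apply: Tx; apply: (first_down _ v z') => //; first lia.
  exact: (last_down c' v').
have v_max : v = h.-1.
  apply/eqP; apply: contraT => ne_v; exfalso; apply: Tx.
  have lt_v1 : v.+1 < h by lia.
  apply: (first_down _ v.+1 z') => //; first by apply: lt_pair.
  by apply: (last_down c' v') => //; apply: lt_pair.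
have v'0 : v' = 0.
  apply/eqP; apply: contraT => ne_v'; exfalso; apply: Tx.
  have lt_v1 : v'.-1 < h by lia.
  apply: (last_down c' v'.-1) => //; first exact: lt_pair.
  by apply: (first_down _ v' z') => //; apply: lt_pair; lia.
split=> //; apply/eqP; apply: contraT => ne_c; exfalso; apply: Tx.
have lt_c1 : c.+1 < c' by lia.
have lt_c1a : c.+1 < a by lia.
have h_gt1 : 1 < h by have := h1; lia.
apply: (last_down c.+1 0) => //; [lia|exact: lt_pair|].
apply: (first_down _ h.-1 z') => //; [lia|lia|by apply: lt_pair; lia|].
by apply: (last_down c' v') => //; [lia|apply: lt_pair; lia].
Qed.

End Compressed.

(** Compress in the first and in the last coordinate as long as this lowers the
    sum of the codes.  For the compressed set, [compressed_gap] shows that a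
    missing point has at least the degree of any larger point of the set (compared
    with the latter, its first coordinate is one less, its last coordinate at
    least one more), so that
    [initial_count] concludes. *)
Lemma lex_optimal_step a hs b :
    (vol hs = 1 -> a <= 1) -> lex_optimal (rcons hs b) -> lex_optimal (a :: hs) ->
  lex_optimal (a :: rcons hs b).
Proof.
move=> hs1 opt_tl opt_hd T u.
have [n] := ubnP (code_sum (a :: rcons hs b) T).
elim: n T => // n IH T; rewrite ltnS => le_n dT.
have step T' C : compresses (a :: rcons hs b) u T T' C -> ~~ C ->
    high_part (a :: rcons hs b) u T
      <= \sum_(x < size_of (a :: rcons hs b) T) (u <= digit_sum (a :: rcons hs b) x).
  case=> dT' sT' hT' wT' nC; rewrite -sT'; apply: leq_trans hT' _; apply: IH => //.
  by apply: leq_trans le_n; rewrite (ltn_leqif wT').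
have [fix_first|] := boolP [forall c : 'I_a,
    initial (vol (rcons hs b)) (fun y => T (c * vol (rcons hs b) + y))]; last first.
  exact: step (compress_first u opt_tl dT).
rewrite -rcons_cons in dT step *.
have [fix_last|] := boolP [forall y : 'I_b,
    initial (vol (a :: hs)) (fun v => T (v * b + y))]; last first.
  exact: step (compress_last u opt_hd dT).
apply: (@initial_count _ T (fun x => u <= digit_sum (rcons (a :: hs) b) x)) => x y.
rewrite vol_rcons vol_cons => lt_xy lt_y; have lt_x := ltn_trans lt_xy lt_y.
case/pairP: lt_x lt_xy => _ [z [/pairP[c [v [lt_c lt_v ->]]] lt_z ->]].
case/pairP: lt_y => _ [z' [/pairP[c' [v' [lt_c' lt_v' ->]]] lt_z' ->]] lt_xy Ty Tx.
have [||c'E -> -> lt_z'z] :=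
  compressed_gap hs1 _ _ lt_c lt_v lt_z lt_c' lt_v' lt_z' lt_xy Ty Tx.
- by move=> e lt_e; have := forallP fix_first (Ordinal lt_e); rewrite vol_rcons.
- by move=> e lt_e; have := forallP fix_last (Ordinal lt_e); rewrite vol_cons.
move/leq_trans; apply.
have lt0h : 0 < vol hs by lia.
rewrite c'E in lt_c' *.
rewrite !digit_sum_rcons ?vol_cons ?pair_lt ?digit_sum_cons ?digit_sum0 //; lia.
Qed.

Lemma vol_le1 hs : vol hs = 1 -> all (eq_op^~ 1) hs.
Proof.
elim: hs => //= d hs IH; rewrite vol_cons => /eqP; rewrite muln_eq1 => /andP[-> /eqP].
exact: IH.
Qed.

(** The theorem of Clements and Lindstrom, in the form that among the downsets of
    a given size initial segments maximize the number of points of degree at least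
    [u].  The order of the side lengths matters in dimension two, and in
    [lex_optimal_step] for a middle box reduced to a point. *)
Theorem lex_optimal_sorted ds : sorted leq ds -> lex_optimal ds.
Proof.
have [n] := ubnP (size ds); elim: n ds => // n IH [|a ds] lt_n ds_sorted.
  exact: lex_optimal_nil.
case/lastP: ds lt_n ds_sorted => [|hs b] lt_n ds_sorted; first exact: lex_optimal1.
rewrite /= size_rcons ltnS in lt_n; case: hs lt_n ds_sorted => [|d hs] lt_n ds_sorted.
  by apply: lex_optimal2; move: ds_sorted => /= /andP[].
apply: lex_optimal_step.
(* middle sides all equal to 1 force the first side, which is shorter, to be 1 *)
- by move: ds_sorted => /= /andP[le_ad _] /vol_le1 /= /andP[/eqP d1 _]; rewrite -{1}d1.
- by apply: IH; rewrite ?size_rcons //; apply: path_sorted ds_sorted.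
- apply: IH => //; move: ds_sorted; rewrite -rcons_cons -cats1.
  by move/cat_sorted2 => [].
Qed.

(** * Codes of the points of a box *)

Definition dims m (d : 'I_m -> nat) : seq nat := [seq d i | i <- enum 'I_m].
Definition code m (d a : 'I_m -> nat) := \sum_i a i * \prod_(j < m | i < j) d j.

Lemma vol_dims m (d : 'I_m -> nat) : vol (dims d) = \prod_i d i.
Proof. by rewrite /vol /dims big_map big_enum. Qed.

Lemma dimsS m (d : 'I_m.+1 -> nat) : dims d = d ord0 :: dims (d \o lift ord0).
Proof. by rewrite /dims enum_ordSl /= -map_comp. Qed.

Lemma codeS m (d a : 'I_m.+1 -> nat) :
  code d a = a ord0 * vol (dims (d \o lift ord0)) + code (d \o lift ord0) (a \o lift ord0).
Proof.
rewrite /code big_ord_recl /= vol_dims; congr (_ * _ + _).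
  by rewrite big_mkcond big_ord_recl /= mul1n.
apply: eq_bigr => i _; congr (_ * _).
by rewrite [LHS]big_mkcond big_ord_recl /= mul1n -big_mkcond.
Qed.

Lemma code_lt m (d a : 'I_m -> nat) : (forall i, a i < d i) -> code d a < vol (dims d).
Proof.
elim: m d a => [|m IH] d a lt_a; first by rewrite /code vol_dims !big_ord0.
rewrite codeS dimsS vol_cons pair_lt // IH // => i; exact: lt_a.
Qed.

Lemma digit_sum_code m (d a : 'I_m -> nat) : (forall i, a i < d i) ->
  digit_sum (dims d) (code d a) = \sum_i a i.
Proof.
elim: m d a => [|m IH] d a lt_a; first by rewrite /dims enum_ord0 big_ord0.
rewrite codeS dimsS digit_sum_cons ?code_lt ?IH ?big_ord_recl // => i; exact: lt_a.
Qed.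

Lemma digit_le_code m (d a b : 'I_m -> nat) :
    (forall i, a i < d i) -> (forall i, b i < d i) ->
  digit_le (dims d) (code d a) (code d b) = [forall i, a i <= b i].
Proof.
elim: m d a b => [|m IH] d a b lt_a lt_b.
  rewrite /dims enum_ord0 /code !big_ord0 /=.
  by apply/esym/forallP => -[].
have [lt_a' lt_b'] := (fun i => lt_a (lift ord0 i), fun i => lt_b (lift ord0 i)).
rewrite !codeS dimsS digit_le_cons ?code_lt // IH //.
apply/andP/forallP => [[le0 /forallP le_l] i|le_ab]; last by split=> //; apply/forallP => i /=.
by have [j ->|->] := unliftP ord0 i; [exact: le_l|].
Qed.

Lemma code_lex m (d a b : 'I_m -> nat) i :
    (forall j, a j < d j) -> a i < b i -> (forall j : 'I_m, j < i -> a j = b j) ->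
  code d a < code d b.
Proof.
elim: m d a b i => [|m IH] d a b i lt_a; first by case: i.
have lt_a' j : (a \o lift ord0) j < (d \o lift ord0) j by apply: lt_a.
rewrite !codeS; have [j ->|->] := unliftP ord0 i => lt_ab eq_ab; last first.
  have := code_lt lt_a'; have := leq_mul lt_ab (leqnn (vol (dims (d \o lift ord0)))); lia.
rewrite eq_ab // ltn_add2l; apply: (IH _ _ _ j) => // k lt_k /=.
by apply: eq_ab; rewrite /= /bump /=; lia.
Qed.

Section BoxCode.
Variables (m : nat) (d : 'I_m -> nat).

(** One less than the position of [a] in lexicographic order. *)
Definition box_code (a : box d) := code d (fun i => a i).

Lemma box_code_lt a : box_code a < vol (dims d).
Proof. by apply: code_lt => i; apply: ltn_ord. Qed.

Lemma lex_lt_code (a b : box d) : lex_lt a b -> box_code a < box_code b.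
Proof.
case/existsP => i /andP[lt_ab /forallP eq_ab]; apply: (code_lex (i := i)) => // j lt_j.
by move: (eq_ab j); rewrite lt_j => /eqP ->.
Qed.

Lemma lex_leE (a b : box d) : lex_le a b = (box_code a <= box_code b).
Proof.
apply/idP/idP => [/orP[/eqP -> //|/lex_lt_code/ltnW //]|le_ab].
have /orP[//|/orP[/eqP-> |/lex_lt_code]] := lex_le_total a b; last by rewrite ltnNge le_ab.
by rewrite /lex_le eqxx.
Qed.

Lemma box_code_inj : injective box_code.
Proof.
by move=> a b eq_ab; apply: lex_le_anti; rewrite !lex_leE eq_ab leqnn.
Qed.

Lemma card_box : #|{: box d}| = vol (dims d).
Proof.
rewrite card_dep_ffun vol_dims foldrE big_map big_enum /=.
by apply: eq_bigr => i _; rewrite card_ord.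
Qed.

Lemma box_codeP x : x < vol (dims d) -> exists a, box_code a = x.
Proof.
move=> lt_x; pose f (a : box d) := Ordinal (box_code_lt a).
have f_inj : injective f by move=> a b /(congr1 val) /box_code_inj.
have [|g _ fK] := @inj_card_bij _ _ f f_inj; first by rewrite card_ord card_box.
by exists (g (Ordinal lt_x)); rewrite -[LHS]/(val (f _)) fK.
Qed.

Lemma sum_box (F : nat -> nat) : \sum_(x < vol (dims d)) F x = \sum_(a : box d) F (box_code a).
Proof.
pose f (a : box d) := Ordinal (box_code_lt a).
rewrite (reindex f) //=; apply: onW_bij; apply: inj_card_bij.
  by move=> a b /(congr1 val) /box_code_inj.
by rewrite card_ord card_box.
Qed.

(** The codes of a downset of the box form a downset of codes, to which
    [lex_optimal_sorted] applies. *)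
Lemma lex_optimal_box (L : {set box d}) u :
    (forall i j : 'I_m, i <= j -> d i <= d j) ->
    (forall a b : box d, (forall i, a i <= b i) -> b \in L -> a \in L) ->
  #|L :&: box_ge d u| <= #|[set a : box d in box_ge d u | box_code a < #|L| ]|.
Proof.
move=> d_sorted L_down.
pose T x := [exists a in L, box_code a == x].
have TE a : T (box_code a) = (a \in L).
  apply/existsP/idP => [[b /andP[Lb /eqP/box_code_inj <-]] //|La].
  by exists a; rewrite La eqxx.
have dT : downset (dims d) T.
  move=> _ _ /box_codeP[a <-] /box_codeP[b <-].
  rewrite digit_le_code; try by move=> i; apply: ltn_ord.
  by move=> /forallP le_ab; rewrite !TE; apply: L_down.
have ds_sorted : sorted leq (dims d).
  have : sorted leq [seq val i | i <- enum 'I_m] by rewrite val_enum_ord iota_sorted.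
  by rewrite !sorted_map; apply: sub_sorted => i j; apply: d_sorted.
have := lex_optimal_sorted ds_sorted u dT; rewrite (sum_box T).
rewrite (sum_box (fun x => T x && (u <= digit_sum (dims d) x))).
have -> : \sum_a T (box_code a) = #|L|.
  by rewrite -sum1_card [RHS]big_mkcond; apply: eq_bigr => a _; rewrite TE; case: ifP.
have le_L : #|L| <= vol (dims d) by rewrite -card_box max_card.
rewrite -(sum_initial (fun x => (u <= digit_sum (dims d) x) : nat) le_L).
rewrite (sum_box (fun x => (x < #|L|) * (u <= digit_sum (dims d) x))).
have dsE (a : box d) : digit_sum (dims d) (box_code a) = \sum_i a i.
  by apply: digit_sum_code => i; apply: ltn_ord.
congr (_ <= _); rewrite -[RHS]sum1_card [RHS]big_mkcond; apply: eq_bigr => a _.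
  by rewrite !inE TE dsE; case: (_ && _).
by rewrite !inE dsE andbC mulnb; case: (_ && _).
Qed.
End BoxCode.

Section BoxDec.

Variables (m : nat) (d : 'I_m -> nat).

Definition box_dec i (a : box d) : box d :=
  [ffun j => if j == i then Ordinal (leq_ltn_trans (leq_pred _) (ltn_ord (a j))) else a j].

Lemma box_decE i (a : box d) j : box_dec i a j = (if j == i then (a j).-1 else a j) :> nat.
Proof. by rewrite ffunE; case: eqP. Qed.

Lemma box_code_dec i (a : box d) : (0 < a i)%N ->
  (box_code (box_dec i a) + \prod_(j < m | i < j) d j)%N = box_code a.
Proof.
move=> a_gt0; rewrite /box_code /code (bigD1 i) //= [RHS](bigD1 i) //= box_decE eqxx.
rewrite addnAC; congr (_ + _)%N; last first.
  by apply: eq_bigr => j ne_ji; rewrite box_decE (negbTE ne_ji).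
by rewrite -mulSnr prednK.
Qed.

Lemma dec_closed_downset (L : {set box d}) :
    (forall a i, a \in L -> (0 < a i)%N -> box_dec i a \in L) ->
  forall a b : box d, (forall i, a i <= b i)%N -> b \in L -> a \in L.
Proof.
move=> L_dec a b; have [N] := ubnP (\sum_i b i); elim: N b => // N IH b.
rewrite ltnS => le_N le_ab Lb; have [->|ne_ab] := eqVneq a b; first by [].
have [i lt_i] : exists i, (a i < b i)%N.
  apply/existsP; apply: contraNT ne_ab; rewrite negb_exists => /forallP ge_ab.
  apply/eqP/ffunP => i; apply: val_inj; apply/eqP.
  by rewrite eqn_leq le_ab leqNgt ge_ab.
have b_gt0 : (0 < b i)%N by apply: leq_ltn_trans lt_i.
apply: (IH (box_dec i b)); last exact: L_dec.
  apply: leq_trans le_N; rewrite (bigD1 i) //= [X in (_ < X)%N](bigD1 i) //= box_decE eqxx.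
  rewrite -addSn prednK // leq_add2l; apply: leq_sum => j ne_ji.
  by rewrite box_decE (negbTE ne_ji).
move=> j; rewrite box_decE; case: eqP => [->|_] //.
by rewrite -ltnS prednK.
Qed.

End BoxDec.

Import GRing.Theory.
Local Open Scope ring_scope.

(** * Leads of a subspace *)

Lemma free_triangular (K : fieldType) (vT : vectType K) (I : eqType) (s : seq I)
    (v : I -> vT) (phi : I -> 'Hom(vT, K^o)) :
    pairwise (fun a b => phi a (v b) == 0) s ->
    {in s, forall a, phi a (v a) != 0} ->
  free [seq v a | a <- s].
Proof.
elim: s => [|a s IH] /=; first by rewrite nil_free.
case/andP=> /allP phi_a s_pair phi_s; rewrite free_cons IH //; last first.
  by move=> b sb; apply: phi_s; rewrite in_cons sb orbT.
rewrite andbT; apply/negP => va_s.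
have /subvP/(_ _ va_s) : (<<[seq v a | a <- s]>> <= lker (phi a))%VS.
  by apply/span_subvP => _ /mapP[b sb ->]; rewrite memv_ker phi_a.
by rewrite memv_ker (negbTE (phi_s a _)) // mem_head.
Qed.

Lemma free_triangular_key (K : fieldType) (vT : vectType K) (I : eqType) (s : seq I)
    (key : I -> nat) (v : I -> vT) (phi : I -> 'Hom(vT, K^o)) :
    uniq s -> {in s, forall a, phi a (v a) != 0} ->
    {in s &, forall a b, phi a (v b) != 0 -> a != b -> (key b < key a)%N} ->
  free [seq v a | a <- s].
Proof.
move=> s_uniq phi_s phi_key; pose r a b := (key a <= key b)%N.
have s_r : perm_eq (sort r s) s by rewrite perm_sort.
rewrite -(perm_free (perm_map v s_r)); apply: (free_triangular (phi := phi)); last first.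
  by move=> a; rewrite mem_sort; apply: phi_s.
have : pairwise [rel a b | (a != b) && r a b] (sort r s).
  rewrite pairwise_relI -uniq_pairwise sort_uniq s_uniq -sorted_pairwise.
    by apply: sort_sorted => a b; apply: leq_total.
  by move=> a b c; apply: leq_trans.
apply: (@sub_in_pairwise _ (mem s)); last by apply/allP => a; rewrite mem_sort.
move=> a b sa sb /andP[ne_ab le_ab]; apply: contraTT le_ab => phi_ab.
by rewrite -ltnNge phi_key.
Qed.

Section Leads.
Variables (K : finFieldType) (n : nat) (I : finType) (key : I -> nat).
Variable coef : I -> 'Hom('rV[K]_n, K^o).
Hypothesis key_inj : injective key.
Hypothesis coef_sep : forall v, (forall a, coef a v = 0) -> v = 0.

(** The coordinates will be indexed by complements of exponents, so that the
    smallest key plays the role of the leading monomial. *)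
Definition is_lead (v : 'rV[K]_n) a :=
  (coef a v != 0) && [forall b, (key b < key a)%N ==> (coef b v == 0)].

Definition leads (U : {vspace 'rV[K]_n}) : {set I} :=
  [set a | [exists v : 'rV[K]_n, (v \in U) && is_lead v a]].

Lemma leadsP (U : {vspace 'rV[K]_n}) a :
  reflect (exists2 v, v \in U & is_lead v a) (a \in leads U).
Proof.
by rewrite inE; apply: (iffP existsP) => [[v /andP[Uv va]]|[v Uv va]]; exists v; rewrite ?Uv.
Qed.

Lemma leadsS (U V : {vspace 'rV[K]_n}) : (U <= V)%VS -> leads U \subset leads V.
Proof.
move=> sUV; apply/subsetP => a /leadsP[v Uv v_a]; apply/leadsP.
by exists v; rewrite ?(subvP sUV).
Qed.

Lemma exists_lead v : v != 0 -> exists a, is_lead v a.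
Proof.
move=> nz_v; have [a0 va0] : exists a, coef a v != 0.
  apply/existsP; apply: contraNT nz_v; rewrite negb_exists => /forallP v0.
  by apply/eqP/coef_sep => a; apply/eqP; have := v0 a; rewrite negbK.
case: (@arg_minnP _ a0 (fun a => coef a v != 0) key va0) => a va min_a.
exists a; rewrite /is_lead va; apply/forallP => b; apply/implyP => lt_b.
by apply: contraTT lt_b => /min_a; rewrite -leqNgt.
Qed.

(** Vectors of [U] with distinct leads are independent, and a vector of [U] whose
    coordinates vanish at all leads of [U] is zero. *)
Lemma card_leads (U : {vspace 'rV[K]_n}) : #|leads U| = \dim U.
Proof.
apply/eqP; rewrite eqn_leq; apply/andP; split.
  have [w Uw w_a] : exists2 w : I -> 'rV[K]_n, forall a, a \in leads U -> w a \in U &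
      forall a, a \in leads U -> is_lead (w a) a.
    pose w a := odflt 0 [pick v | (v \in U) && is_lead v a].
    suff w_ok a : a \in leads U -> (w a \in U) && is_lead (w a) a.
      by exists w => a /w_ok /andP[].
    case/leadsP => v Uv v_a; rewrite /w; case: pickP => [//|/(_ v)].
    by rewrite Uv v_a.
  have free_w : free [seq w a | a <- enum (leads U)].
    apply: (@free_triangular_key _ _ _ _ key _ coef) => [|a|a b]; rewrite ?enum_uniq ?mem_enum //.
      by case/w_a/andP.
    move=> _ /w_a /andP[_ /forallP/(_ a)]; rewrite implybE -leqNgt => /orP[] //; last by move=> ->.
    by rewrite leq_eqVlt => /predU1P[/key_inj-> _|//]; rewrite eqxx.
  have -> : #|leads U| = size [seq w a | a <- enum (leads U)] by rewrite size_map cardE.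
  rewrite -(eqP free_w); apply: dimvS; apply/span_subvP => _ /mapP[a sa ->].
  by apply: Uw; rewrite -mem_enum.
pose f (v : 'rV[K]_n) : 'rV[K]_#|leads U| := \row_k coef (enum_val k) v.
have f_lin : linear f by move=> c v w; apply/rowP => k; rewrite !mxE linearP.
pose f' := GRing.isLinear.Build K _ _ _ f f_lin.
pose g : {linear 'rV[K]_n -> 'rV[K]_#|leads U|} := HB.pack f f'.
have <- : \dim (linfun g @: U) = \dim U.
  apply: limg_dim_eq; apply/eqP; rewrite -subv0; apply/subvP => v.
  rewrite memv_cap memv_ker memv0 lfunE => /andP[Uv /eqP gv0].
  apply: contraT => /exists_lead[a v_a].
  have Ua : a \in leads U by apply/leadsP; exists v.
  have /rowP/(_ (enum_rank_in Ua a)) := gv0.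
  by rewrite !mxE enum_rankK_in // => va0; move: v_a; rewrite /is_lead va0 eqxx.
by apply: leq_trans (dimvS (subvf _)) _; rewrite dimvf /dim /= mul1n.
Qed.

End Leads.

(** * Evaluation and supports *)

Section Evaluation.

Variables (F : finFieldType) (n : nat).

Definition eval_at k (v : 'rV[F]_n) : F^o := v 0 k.
Lemma eval_at_linear k : linear (eval_at k).
Proof. by move=> c v w; rewrite /eval_at !mxE. Qed.
HB.instance Definition _ k :=
  GRing.isLinear.Build F 'rV[F]_n F^o _ (eval_at k) (eval_at_linear k).

End Evaluation.

Section Supported.
Variables (F : finFieldType) (n : nat) (S : {set 'I_n}).

Definition supported : {vspace 'rV[F]_n} := <<[seq delta_mx 0%R i | i <- enum S]>>%VS.

Lemma dim_supported : (\dim supported <= #|S|)%N.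
Proof. by apply: leq_trans (dim_span _) _; rewrite size_map cardE. Qed.

Lemma supportedP (v : 'rV[F]_n) : reflect (forall i, v 0 i != 0 -> i \in S) (v \in supported).
Proof.
apply: (iffP idP) => [Sv i|v_S].
  apply: contraR => nSi; have : (supported <= lker (linfun (eval_at (F := F) i)))%VS.
    apply/span_subvP => _ /mapP[j Sj ->]; rewrite memv_ker lfunE /= /eval_at mxE eqxx /=.
    by rewrite mem_enum in Sj; case: (i =P j) nSi => // ->; rewrite Sj.
  by move/subvP/(_ v Sv); rewrite memv_ker lfunE.
rewrite (row_sum_delta v); apply: rpred_sum => i _.
have [->|nz] := eqVneq (v 0 i) 0; first by rewrite scale0r rpred0.
by apply/rpredZ/memv_span/mapP; exists i; rewrite ?mem_enum ?v_S.
Qed.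
End Supported.

(** * Exponents of products *)

(** The Newton polynomials below are products of linear factors; bounding all
    their exponents at once by a single monomial is stable under products and
    yields both the total degree and the degree in each variable. *)
Definition supp_below (R : comNzRingType) m (p : {mpoly R[m]}) (c : 'X_{1..m}) :=
  {in msupp p, forall mon, (mon <= c)%MM}.

Lemma supp_below1 (R : comNzRingType) m : supp_below (1 : {mpoly R[m]}) 0%MM.
Proof. by move=> mon; rewrite msupp1 inE => /eqP->; apply: lepm_refl. Qed.

Lemma supp_belowM (R : comNzRingType) m (p q : {mpoly R[m]}) b c :
  supp_below p b -> supp_below q c -> supp_below (p * q) (b + c)%MM.
Proof.
move=> pb qc mon /msuppM_le /allpairsP[[u v] /= [/pb ub /qc vc ->]].
by apply/mnm_lepP => i; rewrite !mnmDE leq_add //; [move/mnm_lepP: ub | move/mnm_lepP: vc].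
Qed.

Lemma supp_below_linear (R : comNzRingType) m (i : 'I_m) (c : R) :
  supp_below ('X_i - c%:MP) U_(i)%MM.
Proof.
move=> mon /msuppB_le; rewrite mem_cat msuppX msuppC inE => /orP[/eqP->|].
  exact: lepm_refl.
by case: ifP => //; rewrite inE => _ /eqP->; apply/mnm_lepP => j; rewrite mnm0E.
Qed.

Lemma supp_below_prod (R : comNzRingType) m (I : Type) (s : seq I) (Q : pred I)
    (p : I -> {mpoly R[m]}) (c : I -> 'X_{1..m}) :
    (forall i, Q i -> supp_below (p i) (c i)) ->
  supp_below (\prod_(i <- s | Q i) p i) (\sum_(i <- s | Q i) c i)%MM.
Proof.
move=> pc; apply: (big_ind2 (@supp_below R m)) => //.
- exact: supp_below1.
- by move=> *; apply: supp_belowM.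
Qed.

(** * The Newton basis of the functions on the grid *)

Section Newton.

Variables (F : finFieldType) (m : nat) (A : 'I_m -> {set F}) (d : 'I_m -> nat).
Variables (n : nat) (P : n.-tuple {dffun forall _ : 'I_m, F}).
Hypothesis card_A : forall i, #|A i| = d i.
Hypothesis P_uniq : uniq P.
Hypothesis P_enum : P =i setXn A.

(** The elements of [A i] are numbered in the order of [enum]; [point_box]
    replaces the coordinates of a point by their numbers. *)
Definition node i j : F := nth 0 (enum (A i)) j.

Lemma point_in k i : tnth P k i \in A i.
Proof. by have := mem_tnth k P; rewrite P_enum => /setXnP. Qed.

Lemma point_index_lt k i : (index (tnth P k i) (enum (A i)) < d i)%N.
Proof. by rewrite -card_A cardE index_mem mem_enum point_in. Qed.

Definition point_box k : box d := [ffun i => Ordinal (point_index_lt k i)].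

Lemma node_point k i : node i (point_box k i) = tnth P k i.
Proof. by rewrite ffunE /node nth_index // mem_enum point_in. Qed.

Lemma node_eq k i j : (j < d i)%N -> (tnth P k i == node i j) = (j == point_box k i).
Proof.
move=> lt_j; rewrite -node_point nth_uniq ?enum_uniq -?cardE ?card_A 1?eq_sym //.
Qed.

Lemma point_box_inj : injective point_box.
Proof.
move=> k l eq_kl; apply: (tuple_uniqP _ P_uniq); apply/ffunP => i.
by rewrite -!node_point eq_kl.
Qed.

Lemma card_points : n = #|{: box d}|.
Proof.
rewrite card_box vol_dims -[LHS](size_tuple P) -(card_uniqP P_uniq).
by rewrite (eq_card P_enum) cardsXn; apply: eq_bigr => i _; rewrite card_A.
Qed.

Lemma box_pointP (a : box d) : exists k, point_box k = a.
Proof.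
have [|g _ gK] := inj_card_bij point_box_inj; first by rewrite card_ord -card_points.
by exists (g a).
Qed.

(** Values of the product of all x_i - node i j with j > a_i.  Indexing by the
    complement of the degree makes [newton a] vanish at all points outside the
    box below [a], and makes its degree sum_i (d_i - 1) - sum_i a_i. *)
Definition newton (a : box d) : 'rV[F]_n :=
  \row_k \prod_i \prod_(j < d i | (a i < j)%N) (tnth P k i - node i j).

Lemma newton_neq0 (a : box d) k : (newton a 0 k != 0) = [forall i, (point_box k i <= a i)%N].
Proof.
rewrite mxE; apply/prodf_neq0/forallP => [nz i | le_ka i _].
  rewrite leqNgt; apply/negP => lt_a; have /prodf_neq0/(_ _ lt_a) := nz i isT.
  by rewrite subr_eq0 node_eq ?eqxx.
apply/prodf_neq0 => j lt_aj; rewrite subr_eq0 node_eq //.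
by apply: contraTneq lt_aj => /val_inj ->; rewrite -leqNgt.
Qed.

(** [newton b] does not vanish at the point [a] only if a <= b, so the values form
    a triangular matrix. *)
Lemma free_newton (s : seq (box d)) : uniq s -> free [seq newton a | a <- s].
Proof.
have [g gE] : exists g : box d -> 'I_n, forall a, point_box (g a) = a.
  by apply: (@fin_all_exists _ (fun=> 'I_n) (fun a k => point_box k = a)) => a; apply: box_pointP.
move=> s_uniq; apply: (@free_triangular_key _ _ _ _ (fun a => vol (dims d) - box_code a)%N
  _ (fun a => linfun (eval_at (g a)))) => // [a _|a b _ _].
  by rewrite lfunE /= newton_neq0 gE; apply/forallP.
rewrite lfunE /= newton_neq0 gE => /forallP le_ab ne_ab.
have le_c : (box_code a <= box_code b)%N.
  apply: leq_sum => i _; exact: leq_mul.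
have ne_c : box_code a != box_code b by rewrite (inj_eq (@box_code_inj _ _)).
have := box_code_lt b; lia.
Qed.

Definition newton_tuple := codom_tuple newton.

Lemma newton_tupleE (a : box d) : newton_tuple`_(enum_rank a) = newton a.
Proof. by rewrite /= nth_codom enum_rankK. Qed.

Lemma free_newton_tuple : free newton_tuple.
Proof. by rewrite /= codomE free_newton ?enum_uniq. Qed.

Lemma newton_basis : basis_of fullv newton_tuple.
Proof.
by rewrite basisEfree free_newton_tuple subvf size_tuple dimvf /dim /= mul1n card_points leqnn.
Qed.

Definition ncoef (a : box d) : 'Hom('rV[F]_n, F^o) :=
  linfun (coord newton_tuple (enum_rank a) : 'rV[F]_n -> F^o).

Lemma ncoef_newton (a b : box d) : ncoef a (newton b) = (a == b)%:R.
Proof.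
rewrite lfunE /= -newton_tupleE (coord_free _ _ free_newton_tuple).
by rewrite (inj_eq enum_rank_inj) eq_sym.
Qed.

Lemma newton_expand v : v = \sum_a ncoef a v *: newton a.
Proof.
rewrite {1}(coord_basis newton_basis (memvf v)) (reindex enum_rank) /=; last first.
  by apply: onW_bij; apply: enum_rank_bij.
by apply: eq_bigr => a _; rewrite lfunE newton_tupleE.
Qed.

Lemma ncoef_sep v : (forall a, ncoef a v = 0) -> v = 0.
Proof. by move=> v0; rewrite (newton_expand v) big1 // => a _; rewrite v0 scale0r. Qed.

(** Multiplication by x_i - c, written as a matrix product to inherit linearity. *)
Definition mulx i c (v : 'rV[F]_n) : 'rV[F]_n := v *m diag_mx (\row_k (tnth P k i - c)).

Lemma mulxE i c v k : mulx i c v 0 k = v 0 k * (tnth P k i - c).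
Proof. by rewrite /mulx mul_mx_diag !mxE. Qed.

(** Multiplying by the next node gives the next Newton function.  For a_i = 0 all
    nodes have been used, and the product vanishes at every point. *)
Lemma mulx_node i (a : box d) :
  mulx i (node i (a i)) (newton a) = if (0 < a i)%N then newton (box_dec i a) else 0.
Proof.
apply/rowP => k; rewrite mulxE.
case: posnP => [a0|a_gt0].
  rewrite [RHS]mxE; have [->|] := eqVneq (newton a 0 k) 0; first by rewrite mul0r.
  rewrite newton_neq0 => /forallP/(_ i); rewrite a0 leqn0 => /eqP k0.
  by have := node_point k i; rewrite k0 => ->; rewrite subrr mulr0.
rewrite !mxE (bigD1 i) //= [RHS](bigD1 i) //= mulrAC; congr (_ * _); last first.
  apply: eq_bigr => j ne_ji; apply: eq_bigl => l.
  by rewrite box_decE (negbTE ne_ji).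
rewrite [RHS](bigD1 (a i)) /=; last by rewrite box_decE eqxx ltn_predL.
rewrite mulrC; congr (_ * _); apply: eq_bigl => l.
by rewrite box_decE eqxx -val_eqE /=; lia.
Qed.

Lemma mulx_is_linear i c : linear (mulx i c).
Proof. by move=> z v w; rewrite /mulx mulmxDl scalemxAl. Qed.
HB.instance Definition _ i c :=
  GRing.isLinear.Build F 'rV[F]_n 'rV[F]_n _ (mulx i c) (mulx_is_linear i c).

Lemma mulx_newton i c (a : box d) :
  mulx i c (newton a)
    = (if (0 < a i)%N then newton (box_dec i a) else 0) + (node i (a i) - c) *: newton a.
Proof.
rewrite -mulx_node; apply/rowP => k; rewrite [RHS]mxE [X in _ = _ + X]mxE !mulxE; ring.
Qed.

Lemma ncoef_mulx i c v (b : box d) :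
  ncoef b (mulx i c v) = (\sum_(a : box d | (0 < a i)%N && (box_dec i a == b)) ncoef a v)
     + (node i (b i) - c) * ncoef b v.
Proof.
rewrite {1}(newton_expand v) linear_sum linear_sum /=.
rewrite (eq_bigr (fun a : box d => (if (0 < a i)%N && (box_dec i a == b) then ncoef a v else 0)
   + (if a == b then (node i (a i) - c) * ncoef a v else 0))); last first.
  move=> a _; rewrite linearZ linearZ /= mulx_newton linearD linearZ /= ncoef_newton.
  rewrite scalerDr; congr (_ + _).
    case: ifP => _ /=; last by rewrite linear0 scaler0.
    by rewrite ncoef_newton eq_sym; case: eqP => _; rewrite ?scaler0 // [_ *: _]mulr1.
  rewrite eq_sym; case: eqP => _; rewrite ?scaler0 // /GRing.scale /= mulr1 mulrC //.
by rewrite big_split /= -!big_mkcond /= big_pred1_eq.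
Qed.

(** Lowering the i-th coordinate lowers all codes by the same amount, hence
    respects their order; so multiplication by x_i - node i (a_i) moves the lead
    [a] down by one step. *)
Lemma lead_mulx i v (a : box d) : (0 < a i)%N -> is_lead (@box_code _ d) ncoef v a ->
  is_lead (@box_code _ d) ncoef (mulx i (node i (a i)) v) (box_dec i a).
Proof.
move=> a_gt0 /andP[va /forallP v_a].
have v0 b : (box_code b < box_code a)%N -> ncoef b v = 0.
  by move=> lt_b; apply/eqP; move: (v_a b); rewrite lt_b.
have lt_dec : (box_code (box_dec i a) < box_code a)%N.
  rewrite -[X in (_ < X)%N](box_code_dec a_gt0) -[X in (X < _)%N]addn0 ltn_add2l.
  by apply: prodn_cond_gt0 => j _; apply: leq_ltn_trans (ltn_ord (a j)).
apply/andP; split.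
  rewrite ncoef_mulx (v0 (box_dec i a)) // mulr0 addr0 (bigD1 a) ?a_gt0 /= ?eqxx //.
  rewrite big1 ?addr0 // => b /andP[/andP[b_gt0 /eqP eq_ba] ne_ba].
  case/eqP: ne_ba; apply: (@box_code_inj _ d).
  by rewrite -(box_code_dec b_gt0) eq_ba box_code_dec.
apply/forallP => b; apply/implyP => lt_b.
rewrite ncoef_mulx (v0 b) ?mulr0 ?addr0; last exact: ltn_trans lt_b lt_dec.
rewrite big1 // => e /andP[e_gt0 /eqP eq_eb]; apply: v0.
by rewrite -(box_code_dec e_gt0) -(box_code_dec a_gt0) ltn_add2r eq_eb.
Qed.

(** * The code in the Newton basis *)

Variable e : nat.
Let k := (\sum_i (d i - 1))%N.

Definition newton_poly (a : box d) : {mpoly F[m]} :=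
  \prod_i \prod_(j < d i | (a i < j)%N) ('X_i - (node i j)%:MP).

Lemma newton_poly_below a :
  supp_below (newton_poly a) [multinom (d i - 1 - a i)%N | i < m].
Proof.
have below i : supp_below (\prod_(j < d i | (a i < j)%N) ('X_i - (node i j)%:MP))
    (\sum_(j < d i | (a i < j)%N) U_(i))%MM.
  by apply: supp_below_prod => j _; apply: supp_below_linear.
move=> mon /(@supp_below_prod _ _ _ _ predT _ _ (fun i _ => below i)).
move=> /mnm_lepP le_mon; apply/mnm_lepP => i; apply: leq_trans (le_mon i) _.
rewrite mnmE mnm_sumE (bigD1 i) //= addnC big1 ?add0n; last first.
  move=> j ne_ji; rewrite mnm_sumE big1 // => l _.
  by rewrite mnm1E (negbTE ne_ji).
rewrite mnm_sumE (eq_bigr (fun=> 1%N)); last by move=> j _; rewrite mnm1E eqxx.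
rewrite -subnDA add1n -(row_cells (a i).+1 (leqnn (d i))) big_mkcond.
by apply: leq_sum => j _; rewrite ltn_ord; case: (a i < j)%N.
Qed.

Lemma newton_in_code (a : box d) : a \in box_ge d (k - e) ->
  newton a \in cartesian_code d e P.
Proof.
rewrite inE => ge_a; apply/cartesian_codeP; exists (newton_poly a).
  rewrite reduced_mpolyE; apply/allP => mon /newton_poly_below /mnm_lepP le_mon.
  have le_i i : (mon i <= d i - 1 - a i)%N by have := le_mon i; rewrite mnmE.
  apply/andP; split; last first.
    by apply/forallP => i; have := le_i i; have := ltn_ord (a i); lia.
  have : (mdeg mon <= \sum_i (d i - 1 - a i))%N.
    by rewrite mdegE; apply: leq_sum => i _; apply: le_i.
  have : (\sum_i (d i - 1 - a i) + \sum_i a i = k)%N.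
    by rewrite -big_split; apply: eq_bigr => i _ /=; have := ltn_ord (a i); lia.
  lia.
apply/rowP => l; rewrite !mxE rmorph_prod; apply: eq_bigr => i _ /=.
rewrite rmorph_prod; apply: eq_bigr => j _ /=.
by rewrite mevalB mevalXU mevalC.
Qed.

Definition eval_monom (mon : 'X_{1..m}) : 'rV[F]_n :=
  \row_l \prod_i tnth P l i ^+ mon i.

Lemma eval_monom0 (a : box d) :
  eval_monom 0%MM = newton [ffun i => rev_ord (Ordinal (leq_ltn_trans (leq0n _) (ltn_ord (a i))))].
Proof.
apply/rowP => l; rewrite !mxE; apply: eq_bigr => i _.
rewrite mnm0E expr0 big1 // => j; rewrite ffunE /= subn1.
by have := ltn_ord j; lia.
Qed.

Lemma eval_monomS i (mon : 'X_{1..m}) : mon i != 0%N ->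
  eval_monom mon = mulx i 0 (eval_monom (mon - U_(i))%MM).
Proof.
move=> nz_i; apply/rowP => l; rewrite mulxE subr0 !mxE (bigD1 i) //= [in RHS](bigD1 i) //=.
rewrite mulrAC; congr (_ * _).
  by rewrite mnmBE mnm1E eqxx -exprSr subn1 prednK // lt0n.
by apply: eq_bigr => j ne_ji; rewrite mnmBE mnm1E eq_sym (negbTE ne_ji) subn0.
Qed.

(** The functions with Newton coordinates in degrees at most D (that is, at indices
    of sum at least k - D) are taken by multiplication by x_i to those for D + 1.
    The constant 1 is the Newton function of the largest index. *)
Lemma ncoef_monom mon (a : box d) :
  ncoef a (eval_monom mon) != 0 -> (k <= \sum_i a i + mdeg mon)%N.
Proof.
have [D] := ubnP (mdeg mon); elim: D mon a => // D IH mon a; rewrite ltnS => le_D.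
have [->|nz_mon] := eqVneq mon 0%MM.
  rewrite (eval_monom0 a) ncoef_newton //; set top := finfun _.
  have topE i : top i = (d i - 1)%N :> nat by rewrite ffunE.
  case: (a =P top) => [a_top _|_]; last by rewrite eqxx.
  rewrite mdeg0 addn0 leq_eqVlt; apply/orP; left; apply/eqP.
  by apply: eq_bigr => i _; rewrite -topE -a_top.
have [i nz_i] : exists i, mon i != 0%N.
  apply/existsP; apply: contraNT nz_mon; rewrite negb_exists => /forallP mon0.
  by apply/eqP/mnmP => i; rewrite mnm0E; apply/eqP; have := mon0 i; rewrite negbK.
have degE : mdeg mon = (mdeg (mon - U_(i))%MM).+1.
  by rewrite -{1}(submK (_ : (U_(i) <= mon)%MM)) ?lep1mP // mdegD mdeg1 addn1.
rewrite (eval_monomS nz_i) ncoef_mulx //; apply: contraR; rewrite -ltnNge => lt_k.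
have IH' (b : box d) : (\sum_j b j + mdeg (mon - U_(i)) < k)%N ->
    ncoef b (eval_monom (mon - U_(i))%MM) = 0.
  by move=> lt_b; apply/eqP; apply: contraTT lt_b => /IH; rewrite -leqNgt; apply; lia.
rewrite (IH' a) ?mulr0 ?addr0; last by lia.
rewrite big1 // => b /andP[b_gt0 /eqP eq_ba]; apply: IH'.
suff deg_b : (\sum_j b j = (\sum_j a j).+1)%N by rewrite deg_b addSnnS -degE.
rewrite -eq_ba (bigD1 i) //= [in RHS](bigD1 i) //= box_decE eqxx -addSn prednK //.
by congr (_ + _)%N; apply: eq_bigr => j ne_ji; rewrite box_decE (negbTE ne_ji).
Qed.

Lemma ncoef_code v (a : box d) : v \in cartesian_code d e P ->
  ncoef a v != 0 -> a \in box_ge d (k - e).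
Proof.
move=> /cartesian_codeP[f]; rewrite reduced_mpolyE => /allP f_red ->.
have -> : \row_l f.@[tnth P l] = \sum_(mon <- msupp f) f@_mon *: eval_monom mon.
  by apply/rowP => l; rewrite summxE !mxE mevalE; apply: eq_bigr => mon _; rewrite !mxE.
rewrite linear_sum inE leq_subLR addnC; apply: contraR => lt_k.
rewrite big_seq big1 // => mon /f_red /andP[le_e _].
rewrite linearZ /= (_ : ncoef a (eval_monom mon) = 0) ?scaler0 //; apply/eqP.
apply: contraNT lt_k => /ncoef_monom /leq_trans; apply.
by rewrite leq_add2l.
Qed.

End Newton.

(** * Generalized Hamming weights *)

Theorem theorem5p4 (F : finFieldType) (m : nat) (A : 'I_m -> {set F})
    (d : 'I_m -> nat) (e n : nat) (P : n.-tuple {dffun forall _ : 'I_m, F})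
    (r : nat)
    (A_neq0 : forall i, A i != set0)
    (card_A : forall i, #|A i| = d i)
    (d_sorted : forall i j : 'I_m, (i <= j)%N -> (d i <= d j)%N)
    (P_uniq : uniq P)
    (P_enum : P =i setXn A)
    (e_gt0 : (0 < e)%N)
    (e_le : (e <= \sum_i (d i - 1))%N)
    (r_ge1 : (1 <= r)%N)
    (r_le : (r <= \dim (cartesian_code d e P))%N) :
  exists2 a : box d,
    lex_nth (box_ge d (\sum_i (d i - 1) - e)) r = Some a &
    ghw r (cartesian_code d e P)
      = (1 + \sum_i a i * \prod_(j < m | (i < j)%N) d j)%N.
Proof.
set u := (\sum_i (d i - 1) - e)%N; set C := cartesian_code d e P.
have [D [sDC dimD suppD]] := ghw_min r_le.
pose lead := leads (@box_code m d) (ncoef A P).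
have card_lead U : #|lead U| = \dim U.
  by apply: card_leads; [apply: box_code_inj | apply: ncoef_sep].
have lead_D : lead D \subset box_ge d u.
  apply/subsetP => a /leadsP[v /(subvP sDC) Cv /andP[va _]]; exact: ncoef_code Cv va.
pose s := sort (@lex_le m d) (enum (box_ge d u)).
have s_uniq : uniq s by rewrite sort_uniq enum_uniq.
have mem_s a : (a \in s) = (a \in box_ge d u) by rewrite mem_sort mem_enum.
have s_sorted : sorted (@lex_le m d) s by apply: sort_sorted; apply: lex_le_total.
have le_r_s : (r <= size s)%N.
  by rewrite size_sort -cardE -dimD -card_lead subset_leq_card.
have [a0 _] : exists a0, a0 \in s.
  case: s le_r_s {s_uniq mem_s s_sorted} => [|a s _]; first by rewrite /=; lia.
  by exists a; apply: mem_head.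
have lt_r_s : (r.-1 < size s)%N by lia.
set a := nth a0 s r.-1.
have nth_le i j : (i <= j < size s)%N -> (box_code (nth a0 s i) <= box_code (nth a0 s j))%N.
  case/andP=> le_ij lt_j; rewrite -lex_leE.
  apply: (sorted_leq_nth (@lex_le_trans _ _) _ _ s_sorted) => //.
  - by move=> b; rewrite /lex_le eqxx.
  - exact: leq_ltn_trans lt_j.
exists a; first by rewrite /lex_nth onthE -/s (nth_map a0).
rewrite (_ : (1 + _)%N = (box_code a).+1) //; apply/eqP; rewrite eqn_leq; apply/andP; split.
  (* the Newton functions of the first r indices attain the bound *)
  pose D' := <<[seq newton A P b | b <- take r s]>>%VS.
  have sD'C : (D' <= C)%VS.
    apply/span_subvP => _ /mapP[b /mem_take sb ->]; apply: newton_in_code => //.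
    by move: sb; rewrite mem_s.
  have dimD' : \dim D' = r.
    have free_r : free [seq newton A P b | b <- take r s].
      by apply: free_newton => //; apply: take_uniq.
    by rewrite (eqP free_r) size_map size_takel.
  apply: leq_trans (ghw_le sD'C dimD') _.
  have supp_le l : l \in supp D' -> (box_code (point_box card_A P_enum l) <= box_code a)%N.
    rewrite inE => /existsP[c /andP[D'c]]; apply: contraR; rewrite -ltnNge => lt_a.
    suff : (D' <= lker (linfun (eval_at (F := F) l)))%VS.
      by move/subvP/(_ c D'c); rewrite memv_ker lfunE.
    apply/span_subvP => _ /mapP[b sb ->]; rewrite memv_ker lfunE /=.
    apply: contraTT lt_a => nz_b; rewrite -leqNgt.
    apply: (@leq_trans (box_code b)).
      move: nz_b; rewrite -[_ != 0]/(newton A P b 0 l != 0) newton_neq0 => /forallP le_lb.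
      by apply: leq_sum => i _; apply: leq_mul.
    have sz_b : (index b (take r s) < r)%N by rewrite -{2}(size_takel le_r_s) index_mem.
    rewrite -(nth_index a0 sb) nth_take //; apply: nth_le; lia.
  pose f l := inord (box_code (point_box card_A P_enum l)) : 'I_(box_code a).+1.
  have f_inj : {in supp D' &, injective f}.
    move=> l l' /supp_le le_l /supp_le le_l' /(congr1 val).
    by rewrite /= !inordK // => /box_code_inj /point_box_inj; apply.
  by rewrite -(card_in_imset f_inj) -[leqRHS]card_ord max_card.
(* the leads of the functions supported on supp D form a downset *)
rewrite -suppD ltnNge; apply/negP => le_a.
pose V := supported F (supp D); pose L := lead V.
have sDV : (D <= V)%VS.
  apply/subvP => v Dv; apply/supportedP => i nz_v.
  by rewrite inE; apply/existsP; exists v; rewrite Dv.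
have le_L : (#|L| <= #|supp D|)%N by rewrite card_lead dim_supported.
have L_dec b i : b \in L -> (0 < b i)%N -> box_dec i b \in L.
  move=> /leadsP[v /supportedP v_S v_b] b_gt0; apply/leadsP.
  exists (mulx P i (node A i (b i)) v); last exact: lead_mulx.
  apply/supportedP => l; rewrite mulxE mulf_eq0 negb_or => /andP[nz_v _].
  exact: v_S.
(* at most r - 1 indices of degree >= u have a code below that of a *)
have := lex_optimal_box u d_sorted (dec_closed_downset L_dec); apply/negP; rewrite -ltnNge.
apply: (@leq_trans r); last first.
  rewrite -dimD -card_lead; apply: subset_leq_card; rewrite subsetI lead_D andbT.
  exact: leadsS.
rewrite -[r]prednK // ltnS -(size_takel (ltnW lt_r_s)).
apply: leq_trans (card_size _); apply: subset_leq_card; apply/subsetP => b.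
rewrite inE => /andP[sb lt_b].
have sb' : b \in s by rewrite mem_s.
rewrite in_take //; rewrite ltnNge; apply/negP => le_rb.
have := @nth_le r.-1 (index b s); rewrite index_mem sb' le_rb nth_index // -/a.
move=> /(_ isT); rewrite leqNgt => /negP; apply.
exact: leq_trans lt_b (leq_trans le_L le_a).
Qed.
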